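(* Assume there is a constant $0<c_1<\infty$ such that $\max_{1\le i\le n}|f_0(x_i)|\le c_1$. Let $C_0>0$ and for $m\in\mathcal{M}$ let $$\hat f_m=\arg\min_{t\in \mathcal{S}_m\cap \mathbb{L}_\infty(C_0)}\gamma_n(t),\qquad f_m=\arg\min_{t\in \mathcal{S}_m\cap \mathbb{L}_\infty(C_0)}\gamma(t).$$ Let $\{L_m\}_{m\in\mathcal{M}}$ be positive numbers with $\Sigma=\sum_{m\in\mathcal{M}}\exp(-L_mD_m)<\infty$. Let $\mathrm{pen}:\mathcal{M}\to\mathbb{R}_+$ satisfy, for all $m\in\mathcal{M}$, $$\mathrm{pen}(m)\ge \lambda\frac{D_m}{n}\Big(\frac12+\sqrt{5L_m}\Big)^2,$$ where $\lambda$ is a (suitable) positive constant depending on $c_1$, and let $\hat m=\arg\min_{m\in\mathcal{M}}\{\gamma_n(\hat f_m)+\mathrm{pen}(m)\}$. Then $$\mathbb{E}_{f_0}\big[\mathcal{K}(\mathbb{P}_{f_0}^{(n)},\mathbb{P}_{\hat f_{\hat m}}^{(n)})\big]\le C\inf_{m\in\mathcal{M}}\big\{\mathcal{K}(\mathbb{P}_{f_0}^{(n)},\mathbb{P}_{f_m}^{(n)})+\mathrm{pen}(m)\big\}+C_1\frac{\Sigma}{n}$$ and $$\mathbb{E}_{f_0}\|\hat f_{\hat m}-f_0\|_n^2\le C'\inf_{m\in\mathcal{M}}\big\{\|f_0-f_m\|_n^2+\mathrm{pen}(m)\big\}+C_1'\frac{\Sigma}{n},$$ where $C,C',C_1,C_1'$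 are constants depending on $c_1$ and $C_0$.
   Context: Observations $(Y_1,x_1),\dots,(Y_n,x_n)\in\{0,1\}\times\mathcal{X}$ with deterministic design points $x_i$ and independent $Y_i$ satisfying $\mathbb{E}_{f_0}(Y_i)=\pi_{f_0}(x_i)$, where for $f:\mathcal{X}\to\mathbb{R}$, $\pi_f(x)=e^{f(x)}/(1+e^{f(x)})$, and $f_0$ is unknown. $\mathbb{P}^{(n)}_f$ is the law of $(Y_1,\dots,Y_n)$ when the $Y_i$ are independent Bernoulli$(\pi_f(x_i))$. $\gamma_n(f)=\frac1n\sum_{i=1}^n\{\log(1+e^{f(x_i)})-Y_if(x_i)\}$, $\gamma(f)=\mathbb{E}_{f_0}[\gamma_n(f)]$, and $\mathcal{K}(\mathbb{P}_{f_0}^{(n)},\mathbb{P}_{f}^{(n)})=\frac1n\sum_{i=1}^n\big[\pi_{f_0}(x_i)\log\frac{\pi_{f_0}(x_i)}{\pi_f(x_i)}+(1-\pi_{f_0}(x_i))\log\frac{1-\pi_{f_0}(x_i)}{1-\pi_f(x_i)}\big]$. $\|f\|_n^2=\frac1n\sum_{i=1}^nf(x_i)^2$ and $\langle f,g\rangle_n=\frac1n\sum_i f(x_i)g(x_i)$. A dictionary $\{\phi_1,\dots,\phi_M\}$ orthonormal for $\langle\cdot,\cdot\rangle_n$ is fixed; $\mathcal{M}$ is the set of subsets $m\subset\{1,\dots,M\}$, $\mathcal{S}_m=\{\sum_{j\in m}\beta_j\phi_j\}$, and $D_m$ is the dimension of $\mathrm{span}\{\phi_j,j\in m\}$. $\mathbb{L}_\infty(C_0)=\{f:\max_{1\le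 i\le n}|f(x_i)|\le C_0\}$. *)

(* Defs.v *)
From mathcomp Require Import all_boot all_order all_algebra.
From mathcomp Require Import reals sequences exp.
Set Implicit Arguments. Unset Strict Implicit. Unset Printing Implicit Defensive.
Import Order.TTheory GRing.Theory Num.Theory.
Local Open Scope ring_scope.

Section Logistic.
Variables (R : realType) (X : Type) (n M : nat) (x : 'I_n -> X).

Definition outcome := {ffun 'I_n -> bool}.

Definition pi_ (f : X -> R) (z : X) : R := expR (f z) / (1 + expR (f z)).

(* Expectation under P_{f}^{(n)}: Y_i independent Bernoulli(pi_f(x_i)) *)
Definition Ef (f : X -> R) (g : outcome -> R) : R :=
  \sum_(y : outcome)
     (\prod_(i < n) (if y i then pi_ f (x i) else 1 - pi_ f (x i))) * g y.

Definition gamma_n (y : outcome) (f : X -> R) : R :=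
  n%:R^-1 * \sum_(i < n) (ln (1 + expR (f (x i))) - (y i)%:R * f (x i)).

Definition gamma (f0 f : X -> R) : R := Ef f0 (fun y => gamma_n y f).

Definition KL (f0 f : X -> R) : R :=
  n%:R^-1 * \sum_(i < n)
    (pi_ f0 (x i) * ln (pi_ f0 (x i) / pi_ f (x i))
     + (1 - pi_ f0 (x i)) * ln ((1 - pi_ f0 (x i)) / (1 - pi_ f (x i)))).

Definition inner_n (f g : X -> R) : R := n%:R^-1 * \sum_(i < n) f (x i) * g (x i).
Definition sqnorm_n (f : X -> R) : R := inner_n f f.

Definition orthonormal_n (phi : 'I_M -> X -> R) : Prop :=
  forall j k : 'I_M, inner_n (phi j) (phi k) = (j == k)%:R.

Definition S_ (phi : 'I_M -> X -> R) (m : {set 'I_M}) (t : X -> R) : Prop :=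
  exists beta : 'I_M -> R, t = (fun z => \sum_(j in m) beta j * phi j z).

Definition Linf (C0 : R) (t : X -> R) : Prop := forall i : 'I_n, `|t (x i)| <= C0.

(* D_m = dimension of span{phi_j, j in m}, computed as the rank of the
   family of vectors (phi_j(x_i))_i, j in m (spans of functions restricted to
   the design; equal to the dimension of the span under orthonormality). *)
Definition D_ (phi : 'I_M -> X -> R) (m : {set 'I_M}) : nat :=
  \rank (\matrix_(j < M, i < n) (if j \in m then phi j (x i) else 0) : 'M[R]_(M, n)).

Definition Sigma (phi : 'I_M -> X -> R) (L : {set 'I_M} -> R) : R :=
  \sum_(m : {set 'I_M}) expR (- (L m * (D_ phi m)%:R)).

End Logistic.

(* Main.v *)
Require Import Defs.
From mathcomp Require Import all_boot all_order all_algebra.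
From mathcomp Require Import reals sequences exp.
From mathcomp Require Import boolp ring lra zify.
(** In every model the constrained maximum likelihood gain over [f0] must be bounded by a
    multiple, depending on [c1] only and not on [C0], of the dimension.  For a linear space
    [U] of rank [r] this is obtained by exhibiting one density [Q] relative to the law of
    [Y] with [kap * lr y u <= ln (Q y) + C (r + 1)] for all [y] and all [u] in [U].

    [Q] is the density of a mixture of product laws.  A random subset [Z] of the design
    and fair signs on [Z] are drawn; a point [i] whose leverage relative to [Z] is small is
    predicted by least squares from the signs, and the others by a pair of threshold
    patterns drawn uniformly among those realised by [U], of which there are few by the
    Sauer-Shelah lemma.  Given [u], the mixture is bounded below by Jensen's inequality
    after conditioning [Z] to avoid the points where [|u|] is large and tilting the signs so
    that the least squares prediction has mean [kap * u].  The strict concavity of the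
    log-likelihood pays for this change of measure at every point, and the prediction
    variance sums to at most [r / q], because the leverages of the points of [Z] in [Z] sum
    to at most [r] and a point belongs to [Z] with probability [q] independently of the rest.

    The oracle inequalities follow by weighting the densities [Q m] by [exp (- L m * D m)],
    and by applying the bound to a small multiple, depending on [C0], of the deviation of
    the selected estimator from [f0]. *)

Set Implicit Arguments. Unset Strict Implicit. Unset Printing Implicit Defensive.
Import Order.TTheory GRing.Theory Num.Theory.
Local Open Scope ring_scope.

(** * The logistic log-likelihood ratio *)

Section Scalar.
Variable R : realType.
Implicit Types a u z d : R.

Definition softplus z : R := ln (1 + expR z).
Definition sigmoid z : R := expR z / (1 + expR z).
Definition llr a (y : bool) u : R := y%:R * u - (softplus (a + u) - softplus a).

Lemma onePexp_gt0 z : 0 < 1 + expR z.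
Proof. by rewrite addr_gt0 // expR_gt0. Qed.

Lemma expR_softplus z : expR (softplus z) = 1 + expR z.
Proof. by rewrite lnK // posrE onePexp_gt0. Qed.

Lemma sigmoid_gt0 z : 0 < sigmoid z.
Proof. by rewrite divr_gt0 ?expR_gt0 ?onePexp_gt0. Qed.

Lemma sigmoidC z : 1 - sigmoid z = (1 + expR z)^-1.
Proof. by rewrite /sigmoid; field; rewrite gt_eqF ?onePexp_gt0. Qed.

Lemma sigmoid_lt1 z : sigmoid z < 1.
Proof. by rewrite -subr_gt0 sigmoidC invr_gt0 onePexp_gt0. Qed.

Lemma expR_llr_mean a u :
  sigmoid a * expR (llr a true u) + (1 - sigmoid a) * expR (llr a false u) = 1.
Proof.
have E y : expR (llr a y u) = expR (y%:R * u) * (1 + expR a) / (1 + expR (a + u)).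
  rewrite /llr [LHS]expRD expRN [expR (softplus _ - _)]expRD expRN !expR_softplus.
  by rewrite invf_div mulrA.
rewrite !E mul1r mul0r expR0 sigmoidC /sigmoid expRD.
by field; rewrite -?expRD !gt_eqF ?onePexp_gt0.
Qed.

(** Bounding both likelihood ratios, whose mean is one, below by [1 + x] shows that the mean
    log-likelihood ratio is nonpositive; this is the tangent inequality, with no derivative
    taken. *)
Lemma sp_tangent z d : softplus z + sigmoid z * d <= softplus (z + d).
Proof.
have p0 := sigmoid_gt0 z; have p1 := sigmoid_lt1 z.
have := expR_llr_mean z d.
set x1 := llr z true d; set x0 := llr z false d => H.
have e1 := expR_ge1Dx x1; have e0 := expR_ge1Dx x0.
have : sigmoid z * (1 + x1) + (1 - sigmoid z) * (1 + x0) <= 1 by nra.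
rewrite /x1 /x0 /llr mul1r mul0r; lra.
Qed.

Lemma softplus_ge0 z : 0 <= softplus z.
Proof. by rewrite ln_ge0 // lerDl expR_ge0. Qed.

Lemma softplus_ge z : z <= softplus z.
Proof. by rewrite -ler_expR expR_softplus lerDr. Qed.

Lemma softplus_leexp z : softplus z <= expR z.
Proof. by rewrite -ler_expR expR_softplus expR_ge1Dx. Qed.

Lemma softplus_homo z z' : z <= z' -> softplus z <= softplus z'.
Proof. by move=> h; rewrite -ler_expR !expR_softplus lerD2l ler_expR. Qed.

Lemma softplus_lip z d : 0 <= d -> softplus (z + d) <= softplus z + d.
Proof.
move=> d0; rewrite -ler_expR expRD !expR_softplus mulrDl mul1r expRD lerD2r.
by rewrite -expR0 ler_expR.
Qed.

Lemma softplus_refl z : softplus z = z + softplus (- z).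
Proof.
apply: expR_inj; rewrite expRD !expR_softplus expRN; field.
by rewrite gt_eqF ?expR_gt0.
Qed.

Lemma expR_le_quad d : d <= 2^-1 -> expR d <= 1 + d + 2 * d ^+ 2.
Proof.
move=> d1.
have h := expR_ge1Dx (- d); rewrite expRN in h.
have e0 := expR_gt0 d.
have h2 : (1 - d) * expR d <= 1.
  by rewrite -[leRHS](mulVf (lt0r_neq0 e0)) ler_pM2r.
have : 0 <= d ^+ 2 * (1 - 2 * d) by apply: mulr_ge0; [exact: sqr_ge0|lra].
have: 0 < 1 - d by lra.
move: (expR d) h2 => e h2 h3 h4; nra.
Qed.

(** For small [d], [expR_le_quad] is averaged over the two outcomes; for [|d|] above one half the
    quadratic term dominates the linear ones. *)
Lemma sp_upper z d : softplus (z + d) <= softplus z + sigmoid z * d + 2 * d ^+ 2.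
Proof.
have p0 := sigmoid_gt0 z; have p1 := sigmoid_lt1 z.
have d2 := sqr_ge0 d.
have [dh|dh] := leP d 2^-1; last first.
  have := @softplus_lip z d; nra.
have [dl|dl] := leP (- 2^-1) d; last first.
  have : softplus (z + d) <= softplus z by apply: softplus_homo; lra.
  nra.
rewrite -ler_expR -addrA expRD !expR_softplus.
apply: le_trans (_ : (1 + expR z) * (1 + (sigmoid z * d + 2 * d ^+ 2)) <= _); last first.
  by rewrite ler_pM2l ?onePexp_gt0 // expR_ge1Dx.
apply: le_trans (_ : (1 + expR z) * (1 + sigmoid z * (d + 2 * d ^+ 2)) <= _).
  have -> : (1 + expR z) * (1 + sigmoid z * (d + 2 * d ^+ 2))
    = 1 + expR z * (1 + d + 2 * d ^+ 2).
    by rewrite /sigmoid; field; rewrite gt_eqF ?onePexp_gt0.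
  by rewrite expRD lerD2l ler_pM2l ?expR_gt0 // expR_le_quad.
by rewrite ler_pM2l ?onePexp_gt0 //; nra.
Qed.

Lemma sigmoidN z : sigmoid (- z) = 1 - sigmoid z.
Proof.
rewrite sigmoidC /sigmoid expRN; field.
by rewrite !gt_eqF ?expR_gt0 ?onePexp_gt0 // addrC onePexp_gt0.
Qed.

Lemma sigmoid_lower z (c : R) : 0 <= c -> - c <= z -> (2 * expR c)^-1 <= sigmoid z.
Proof.
move=> c0 cz.
have ez : expR (- c) <= expR z by rewrite ler_expR.
have ec : 1 <= expR c by rewrite -expR0 ler_expR.
have p := onePexp_gt0 z.
rewrite ler_pdivlMr // ler_pdivrMl ?mulr_gt0 ?expR_gt0 //.
have : 1 <= expR c * expR z.
  by rewrite -expRD -expR0 ler_expR; lra.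
have : expR z <= expR c * expR z by rewrite ler_peMl // expR_ge0.
by lra.
Qed.

Lemma softplus_mid x y t : 0 <= t <= 1 ->
  softplus ((1 - t) * x + t * y) <= (1 - t) * softplus x + t * softplus y.
Proof.
case/andP=> t0 t1; set z := _ + _.
have hx := sp_tangent z (x - z); have hy := sp_tangent z (y - z).
rewrite !subrKC in hx hy.
have : (1 - t) * (softplus z + sigmoid z * (x - z))
     + t * (softplus z + sigmoid z * (y - z)) <=
   (1 - t) * softplus x + t * softplus y.
  by apply: lerD; rewrite ler_wpM2l // subr_ge0.
apply: le_trans; rewrite le_eqVlt; apply/orP; left; apply/eqP; rewrite /z; ring.
Qed.

Lemma llr_concave a y x u t : 0 <= t <= 1 ->
  (1 - t) * llr a y x + t * llr a y u <= llr a y ((1 - t) * x + t * u).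
Proof.
move=> ht; have := @softplus_mid (a + x) (a + u) t ht.
rewrite /llr (_ : (1 - t) * (a + x) + t * (a + u) = a + ((1 - t) * x + t * u)); last by ring.
move: (y%:R) => Y; move: (softplus _) (softplus _) (softplus _) (softplus _) => A B C D; lra.
Qed.

Lemma llr_second_order a y z d :
  llr a y z + (y%:R - sigmoid (a + z)) * d - 2 * d ^+ 2 <= llr a y (z + d).
Proof. have := sp_upper (a + z) d; rewrite /llr addrA; lra. Qed.

(* The squared Hellinger distance is at most the Kullback-Leibler divergence, which is
   [softplus (z + d) - softplus z - sigmoid z * d]. *)
Lemma softplus_quad_lower z d (c r : R) : 0 <= c -> `|z| <= c -> `|d| <= r ->
  softplus z + sigmoid z * d + (16 * expR (c + 2 * r))^-1 * d ^+ 2 <= softplus (z + d).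
Proof.
move=> c0 zc dr.
have zl : (2 * expR c)^-1 <= sigmoid z.
  by apply: sigmoid_lower => //; move: zc; rewrite ler_norml => /andP[].
have zu : (2 * expR c)^-1 <= 1 - sigmoid z.
  rewrite -sigmoidN; apply: sigmoid_lower => //; move: zc; rewrite ler_norml; lra.
have := expR_llr_mean z d.
rewrite /llr mul1r mul0r sub0r; set D := softplus (z + d) - softplus z => H.
(* [t] and [s * t] are the square roots of the likelihood ratios at the outcomes [false] and
   [true]. *)
pose t := expR (- D / 2); pose s := expR (d / 2).
have ht : expR (- D) = t ^+ 2.
  by rewrite expr2 -expRD; congr expR; lra.
have hs : expR (d - D) = (s * t) ^+ 2.
  by rewrite expr2 -!expRD; congr expR; lra.
rewrite ht hs in H.
have e1 := expR_ge1Dx (d / 2 - D / 2).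
have e0 := expR_ge1Dx (- D / 2).
have es : expR (d / 2 - D / 2) = s * t by rewrite -expRD; congr expR; lra.
rewrite es in e1; rewrite -/t in e0.
set p := sigmoid z in zl zu H *; set k := (2 * expR c)^-1 in zl zu.
have k0 : 0 < k by rewrite invr_gt0 mulr_gt0 ?expR_gt0.
(* [D - p d >= p (s t - 1)^2 + (1 - p) (t - 1)^2 >= k / 2 * (s t - t)^2] *)
have h1 : p * (s * t - 1) ^+ 2 + (1 - p) * (t - 1) ^+ 2 <= D - p * d.
  have : p * (1 + (d / 2 - D / 2)) + (1 - p) * (1 + - D / 2)
     <= p * (s * t) + (1 - p) * t by apply: lerD; rewrite ler_wpM2l //; lra.
  nra.
have h2 : k / 2 * (t ^+ 2 * (s - 1) ^+ 2) <= D - p * d.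
  apply: le_trans h1.
  have : k * ((s * t - 1) ^+ 2) <= p * (s * t - 1) ^+ 2 by rewrite ler_wpM2r ?sqr_ge0.
  have : k * ((t - 1) ^+ 2) <= (1 - p) * (t - 1) ^+ 2 by rewrite ler_wpM2r ?sqr_ge0.
  have : 0 <= k * ((s * t - 1) + (t - 1)) ^+ 2 by rewrite mulr_ge0 ?sqr_ge0 // ltW.
  lra.
have tr : expR (- r) <= t ^+ 2.
  rewrite -ht ler_expR lerN2 /D.
  have [d0|d0] := leP 0 d.
    have := softplus_lip z d0; move: dr; rewrite ger0_norm //; lra.
  have : softplus (z + d) <= softplus z by apply: softplus_homo; lra.
  have := normr_ge0 d; lra.
have sr : expR (- r) * (d ^+ 2 / 4) <= (s - 1) ^+ 2.
  have [d0|d0] := leP 0 d.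
    have h : d / 2 <= s - 1 by have := expR_ge1Dx (d / 2); rewrite -/s; lra.
    have hr : expR (- r) <= 1.
      rewrite -expR0 ler_expR; have := normr_ge0 d; lra.
    have : d ^+ 2 / 4 <= (s - 1) ^+ 2.
      by rewrite (_ : d ^+ 2 / 4 = (d / 2) ^+ 2); [rewrite lerXn2r ?nnegrE //; lra|field].
    apply: le_trans; rewrite -[leRHS]mul1r ler_wpM2r //.
    by rewrite divr_ge0 ?sqr_ge0.
  have h : - d / 2 <= s^-1 - 1.
    by have := expR_ge1Dx (- d / 2); rewrite mulNr expRN -/s; lra.
  have s0 : 0 < s := expR_gt0 _.
  have hh : s * (- d / 2) <= 1 - s.
    have : s * (- d / 2) <= s * (s^-1 - 1) by rewrite ler_wpM2l // ltW.
    by rewrite mulrBr divff ?gt_eqF // mulr1.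
  have : s ^+ 2 * (d ^+ 2 / 4) <= (s - 1) ^+ 2.
    rewrite (_ : s ^+ 2 * (d ^+ 2 / 4) = (s * (- d / 2)) ^+ 2); last by field.
    rewrite (_ : (s - 1) ^+ 2 = (1 - s) ^+ 2); last by ring.
    by rewrite lerXn2r ?nnegrE //; nra.
  apply: le_trans; rewrite ler_wpM2r ?divr_ge0 ?sqr_ge0 //.
  rewrite expr2 -expRD ler_expR; move: dr; rewrite ltr0_norm //; lra.
have h3 : expR (- r) * (expR (- r) * (d ^+ 2 / 4)) <= t ^+ 2 * (s - 1) ^+ 2.
  apply: ler_pM => //; first exact: expR_ge0.
  by rewrite mulr_ge0 ?expR_ge0 ?divr_ge0 ?sqr_ge0.
have h4 : (16 * expR (c + 2 * r))^-1 * d ^+ 2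
   = k / 2 * (expR (- r) * (expR (- r) * (d ^+ 2 / 4))).
  rewrite /k (_ : c + 2 * r = c + (r + r)); last by ring.
  rewrite !expRD expRN; field; rewrite !gt_eqF ?expR_gt0 //.
have : k / 2 * (expR (- r) * (expR (- r) * (d ^+ 2 / 4)))
    <= k / 2 * (t ^+ 2 * (s - 1) ^+ 2) by rewrite ler_wpM2l // divr_ge0 // ltW.
by rewrite -h4 => h5; move: h2; rewrite /D; lra.
Qed.

End Scalar.

(** * Shrinking a logit deviation, with constants depending on [c] only *)

Section ScalarConstants.
Variable R : realType.
Implicit Types a u z d c : R.

Lemma llr0 a y : llr a y 0 = 0.
Proof. by rewrite /llr addr0 mulr0 !subrr. Qed.

(** Each outcome has probability at least [(2 * expR c)^-1] and the likelihood ratios have mean one,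
    so neither exceeds [2 * expR c]. *)
Lemma llr_le a y u c : `|a| <= c -> llr a y u <= 2 * expR c.
Proof.
move=> ac.
have c0 : 0 <= c := le_trans (normr_ge0 _) ac.
move: (ac); rewrite ler_norml => /andP[a1 a2].
have zl : (2 * expR c)^-1 <= sigmoid a by apply: sigmoid_lower.
have zu : (2 * expR c)^-1 <= 1 - sigmoid a.
  by rewrite -sigmoidN; apply: sigmoid_lower => //; lra.
have k0 : 0 < (2 * expR c)^-1 by rewrite invr_gt0 mulr_gt0 ?expR_gt0.
have kK : (2 * expR c)^-1 * (2 * expR c) = 1.
  by rewrite mulVf // gt_eqF // mulr_gt0 ?expR_gt0.
have := expR_llr_mean a u.
have e1 := expR_gt0 (llr a true u); have e0 := expR_gt0 (llr a false u).
have h : expR (llr a y u) <= 2 * expR c ->  llr a y u <= 2 * expR c.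
  by apply: le_trans; have := expR_ge1Dx (llr a y u); lra.
move=> H; apply: h; rewrite -(ler_pM2l k0) kK.
by case: y; nra.
Qed.

(** Kullback-Leibler divergence of the Bernoulli law with logit [z] relative to the one with logit
    [z + d]. *)
Definition bregman z d : R := softplus (z + d) - softplus z - sigmoid z * d.

Lemma bregman_ge_norm a u c : `|a| <= c ->
  `|u| / (2 * expR c) - expR c <= bregman a u.
Proof.
move=> ac.
have c0 : 0 <= c := le_trans (normr_ge0 _) ac.
move: (ac); rewrite ler_norml => /andP[a1 a2].
have zl : (2 * expR c)^-1 <= sigmoid a by apply: sigmoid_lower.
have zu : (2 * expR c)^-1 <= 1 - sigmoid a.
  by rewrite -sigmoidN; apply: sigmoid_lower => //; lra.
rewrite /bregman; have [u0|u0] := leP 0 u; last first.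
  rewrite ltr0_norm //.
  have h1 := softplus_ge0 (a + u).
  have h3 := softplus_leexp a.
  have h4 : expR a <= expR c by rewrite ler_expR.
  have : - u * (2 * expR c)^-1 <= - u * sigmoid a by rewrite ler_wpM2l //; lra.
  lra.
rewrite ger0_norm //.
have h1 := softplus_ge (a + u).
have h2 := softplus_refl a; have h3 := softplus_leexp (- a).
have h4 : expR (- a) <= expR c by rewrite ler_expR; lra.
have : u * (2 * expR c)^-1 <= u * (1 - sigmoid a) by rewrite ler_wpM2l.
lra.
Qed.

(** The exact size of a large [u] can be forgotten: the outcome that [u] favours is saturated at the
    threshold up to [expR c], and the other outcome only loses beyond it. *)
Lemma llr_tail a y u c t : `|a| <= c -> 0 <= t ->
  (t <= u -> llr a y u <= llr a y t + expR c) /\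
  (u <= - t -> llr a y u <= llr a y (- t) + expR c).
Proof.
move=> ac t0; move: (ac); rewrite ler_norml => /andP[a1 a2].
have ec := expR_ge0 c.
rewrite /llr; split=> ut.
  have sm : softplus (a + t) <= softplus (a + u) by apply: softplus_homo; lra.
  case: y; rewrite ?mul1r ?mul0r; last by lra.
  have h1 := softplus_ge (a + u).
  have h2 := softplus_refl (a + t); have h3 := softplus_leexp (- (a + t)).
  have h4 : expR (- (a + t)) <= expR c by rewrite ler_expR; lra.
  lra.
case: y; rewrite ?mul1r ?mul0r.
  have := @softplus_lip R (a + u) (- t - u).
  rewrite (_ : a + u + (- t - u) = a - t); last by ring.
  lra.
have h1 := softplus_ge0 (a + u).
have h3 := softplus_leexp (a - t).
have h4 : expR (a - t) <= expR c by rewrite ler_expR; lra.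
lra.
Qed.

(** The gain from shrinking is the same for both outcomes, so it holds pointwise and not only in
    mean. *)
Lemma llr_scale a y k u :
  llr a y (k * u) = k * llr a y u + (k * bregman a u - bregman a (k * u)).
Proof. by rewrite /llr /bregman; move: (y%:R) => Y; ring. Qed.

(** Concavity along a ray: [t] lies between [0] and [u], and [k * u] between [k * t] and [u], so a
    gain at [t] passes to [u]. The weight [s] put on [u] is at most [k], which keeps half of the
    gain. *)
Lemma llr_shrink_tail a y k t g u : 0 < k <= 2^-1 -> t != 0 -> 0 <= g ->
  1 <= u / t -> k * llr a y t + g <= llr a y (k * t) ->
  k * llr a y u + g / 2 <= llr a y (k * u).
Proof.
case/andP=> k0 k1 t0 g0; set r := u / t => r1 ht.
have ur : u = r * t by rewrite /r divfK.
have d0 : 0 < r - k by lra.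
pose s := k * (r - 1) / (r - k).
have s0 : 0 <= s by rewrite divr_ge0 ?mulr_ge0 //; lra.
have s1 : s <= k.
  by rewrite /s ler_pdivrMr // ler_pM2l //; lra.
have h1 := @llr_concave R a y (k * t) u s.
have h2 := @llr_concave R a y 0 u r^-1.
rewrite llr0 !mulr0 !add0r in h2.
have rt : r^-1 * u = t by rewrite ur mulKf // gt_eqF //; lra.
rewrite rt in h2.
have r01 : 0 <= r^-1 <= 1.
  by rewrite invr_ge0 invf_le1 ?r1 ?andbT; lra.
have {h2} := h2 r01 => h2.
have e : (1 - s) * (k * t) + s * u = k * u.
  by rewrite ur /s; field; rewrite gt_eqF.
rewrite e in h1.
have {h1} h1 : (1 - s) * llr a y (k * t) + s * llr a y u <= llr a y (k * u).
  by apply: h1; lra.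
apply: le_trans h1.
have h3 : (1 - s) * (k * (r^-1 * llr a y u) + g) <= (1 - s) * llr a y (k * t).
  rewrite ler_wpM2l; [by []|by lra|].
  apply: le_trans ht; rewrite lerD2r ler_pM2l //.
have e2 : (1 - s) * (k * r^-1) + s = k.
  by rewrite /s; field; rewrite !gt_eqF //; lra.
have : (1 - s) * g >= g / 2 by nra.
move: h3; rewrite mulrDr [k * (_ * _)]mulrA [(1 - s) * (_ * _)]mulrA.
have -> : (1 - s) * (k * r^-1) = k - s by rewrite -[in RHS]e2; ring.
lra.
Qed.

(** Shrinking by [k] saves a divergence of order [k] and leaves one of order [k ^ 2]. The gain is
    quadratic below the threshold [t] and constant above it. *)
Lemma llr_constants c : 0 < c ->
  exists k t g c4 c5 : R,
  [/\ 0 < k, 0 < t, 0 < g, 0 < c4 & 0 < c5] /\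
  forall a (y : bool) u, `|a| <= c ->
  [/\ `|u| <= t -> k * llr a y u + c4 * u ^+ 2 <= llr a y (k * u),
      t <= `|u| -> k * llr a y u + g <= llr a y (k * u),
      t <= u -> k * llr a y u + g <= llr a y (k * t),
      u <= - t -> k * llr a y u + g <= llr a y (- (k * t))
    & k * llr a y u <= c5].
Proof.
move=> c0; set E := expR c.
have E1 : 1 <= E by rewrite -expR0 ler_expR ltW.
(* With this [t] the divergence at modulus [t] is at least [2 * (E + 1) - E]. One unit covers the
   shrunk divergence, [E] covers the loss in [llr_tail], and one unit remains as gain. *)
pose t := 4 * E * (E + 1).
have t1 : 1 <= t by rewrite /t; nra.
pose q : R := (16 * expR (c + 2 * t))^-1.
have q0 : 0 < q by rewrite invr_gt0 mulr_gt0 ?expR_gt0.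
(* The three summands yield [kt], [k2] and [kq] in this order. *)
pose S := 2 * t ^+ 2 + 2 + 4 / q.
have S0 : 0 < S.
  have := sqr_ge0 t; have : 0 < 4 / q by rewrite divr_gt0.
  by rewrite /S; lra.
pose k := S^-1.
have k0 : 0 < k by rewrite invr_gt0.
have kS : k * S = 1 by rewrite mulVf // gt_eqF.
have q4 : 0 < 4 / q by rewrite divr_gt0.
have kt : 2 * k * t ^+ 2 <= 1.
  have : 0 <= k * (4 / q) by rewrite mulr_ge0 ?ltW.
  by move: kS; rewrite /S; lra.
have k2 : k <= 2^-1.
  have : 0 <= k * (4 / q) by rewrite mulr_ge0 ?ltW.
  have : 0 <= k * t ^+ 2 by rewrite mulr_ge0 ?sqr_ge0 ?ltW.
  by move: kS; rewrite /S; lra.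
have kq : 4 * k <= q.
  have h1 : k * (4 / q) <= 1.
    have : 0 <= k * t ^+ 2 by rewrite mulr_ge0 ?sqr_ge0 ?ltW.
    by move: kS; rewrite /S; lra.
  by move: h1; rewrite mulrA ler_pdivrMr // mul1r mulrC.
have base a (y : bool) s : `|a| <= c -> `|s| = t ->
    k * llr a y s + k * (E + 1) <= llr a y (k * s).
  move=> ac st; rewrite llr_scale lerD2l.
  have h1 := bregman_ge_norm s ac; rewrite st in h1.
  have h2 := sp_upper a (k * s).
  have st2 : s ^+ 2 = t ^+ 2 by rewrite -[LHS]real_normK ?num_real // st.
  have h3 : bregman a (k * s) <= 2 * k ^+ 2 * t ^+ 2.
    by rewrite -st2 /bregman; lra.
  have h4 : 2 * k ^+ 2 * t ^+ 2 <= k.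
    by rewrite (_ : 2 * k ^+ 2 * t ^+ 2 = k * (2 * k * t ^+ 2)) ?ger_pMr //; ring.
  have h5 : t / (2 * E) = 2 * (E + 1).
    by rewrite /t; field; rewrite gt_eqF // expR_gt0.
  rewrite -/E h5 in h1.
  have : k * (2 * (E + 1) - E) <= k * bregman a s by rewrite ler_pM2l.
  lra.
exists k, t, k, (k * q / 2), (k * (2 * E)); split.
  split=> //; first by lra.
    by rewrite divr_gt0 ?mulr_gt0.
  by rewrite !mulr_gt0 ?expR_gt0.
move=> a y u ac.
have [tl tr] := @llr_tail a y u c t ac ltac:(lra).
split=> [ut|ut|ut|ut|].
- rewrite llr_scale lerD2l.
  have h1 := @softplus_quad_lower R a u c t (ltW c0) ac ut.
  have h2 := sp_upper a (k * u).
  have h3 : k * (q * u ^+ 2) <= k * bregman a u.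
    by rewrite ler_pM2l // /bregman /q; lra.
  have h4 : bregman a (k * u) <= 2 * k ^+ 2 * u ^+ 2 by rewrite /bregman; lra.
  have : k * (4 * k) * u ^+ 2 <= k * q * u ^+ 2.
    by rewrite ler_wpM2r ?sqr_ge0 // ler_pM2l.
  lra.
- have [s [s0 st us]] : exists s, [/\ s != 0, `|s| = t & 1 <= u / s].
    have [u0|u0] := leP 0 u.
      exists t; split; [by lra|by rewrite ger0_norm //; lra|].
      by rewrite ler_pdivlMr ?mul1r; [rewrite ger0_norm in ut|lra].
    exists (- t); split; [by lra|by rewrite normrN ger0_norm //; lra|].
    rewrite invrN mulrN -mulNr ler_pdivlMr ?mul1r; [|by lra].
    by rewrite ltr0_norm in ut.
  have := llr_shrink_tail _ s0 _ us (base a y s ac st).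
  rewrite k0 k2 => /(_ isT) h.
  have : 0 <= k * (E + 1) by rewrite mulr_ge0 //; lra.
  move=> /h; apply: le_trans; rewrite lerD2l; nra.
- have := base a y t ac; rewrite ger0_norm; last by lra.
  move=> /(_ erefl); apply: le_trans.
  have : k * llr a y u <= k * (llr a y t + E) by rewrite ler_pM2l // tl.
  lra.
- have := base a y (- t) ac; rewrite normrN ger0_norm; last by lra.
  move=> /(_ erefl); rewrite mulrN; apply: le_trans.
  have : k * llr a y u <= k * (llr a y (- t) + E) by rewrite ler_pM2l // tr.
  lra.
- by rewrite ler_pM2l // llr_le.
Qed.

End ScalarConstants.

(** * Leverage of a point relative to a subset of the design *)

Section OrthogonalProjection.
Variable R : realFieldType.

Lemma mulmx_tr_eq0 n (w : 'rV[R]_n) : w *m w^T = 0 -> w = 0.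
Proof.
move=> /matrixP/(_ 0 0); rewrite !mxE => h.
apply/rowP=> j; rewrite mxE.
have h0 k : true -> 0 <= w 0 k * w^T k 0 by rewrite mxE -expr2 sqr_ge0.
move/eqP: h; rewrite psumr_eq0 // => /allP /(_ j).
by rewrite mem_index_enum mxE => /(_ isT) /implyP/(_ isT); rewrite mulf_eq0 orbb => /eqP.
Qed.

Lemma gram_unitmx k n (B : 'M[R]_(k, n)) : row_free B -> B *m B^T \in unitmx.
Proof.
move=> Bfree; rewrite -row_free_unit; apply: inj_row_free => v hv.
apply/eqP; rewrite -(mulmx_free_eq0 _ Bfree); apply/eqP.
apply: mulmx_tr_eq0; rewrite trmx_mul !mulmxA -[v *m B *m _]mulmxA.
by rewrite hv mul0mx.
Qed.

(** Orthogonal projector onto the row space of [V], acting on row vectors from the right; a row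
    basis is taken because the rows of [V] may be dependent. *)
Definition projmx k n (V : 'M[R]_(k, n)) : 'M[R]_n :=
  (row_base V)^T *m invmx (row_base V *m (row_base V)^T) *m row_base V.

Section Projmx.
Variables (k n : nat) (V : 'M[R]_(k, n)).

Let B := row_base V.
Let Gunit : B *m B^T \in unitmx.
Proof. by apply/gram_unitmx/row_base_free. Qed.

Lemma projmx_sym : (projmx V)^T = projmx V.
Proof.
rewrite /projmx; move: (row_base V) => A.
by rewrite !trmx_mul trmxK trmx_inv trmx_mul trmxK mulmxA.
Qed.

Lemma base_projmx : B *m projmx V = B.
Proof. by rewrite /projmx !mulmxA mulmxV // mul1mx. Qed.

Lemma projmx_idem : projmx V *m projmx V = projmx V.
Proof. have e : projmx V = (B^T *m invmx (B *m B^T)) *m B by [].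
by rewrite {1}e -(mulmxA _ B) base_projmx -e. Qed.

Lemma projmx_id (v : 'rV_n) : (v <= V)%MS -> v *m projmx V = v.
Proof.
rewrite -(eq_row_base V) => /submxP[x ->].
by rewrite -mulmxA base_projmx.
Qed.

Lemma projmx_sub : (projmx V <= V)%MS.
Proof. by rewrite -(eq_row_base V) submxMl. Qed.

Lemma mxtrace_projmx : \tr (projmx V) = (\rank V)%:R.
Proof. have e : projmx V = (B^T *m invmx (B *m B^T)) *m B by [].
by rewrite e mxtrace_mulC mulmxA mulmxV //; exact: mxtrace1. Qed.

Lemma projmx_diag i : projmx V i i = \sum_j projmx V i j ^+ 2.
Proof.
rewrite -{1}projmx_idem mxE; apply: eq_bigr => j _.
by rewrite expr2; congr (_ * _); rewrite -[in LHS]projmx_sym mxE.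
Qed.

End Projmx.

(** Columns outside [Z] are zeroed and not deleted, so that all projectors share the same index
    set. *)
Definition restrmx k n (V : 'M[R]_(k, n)) (Z : {set 'I_n}) : 'M[R]_(k, n) :=
  V *m diag_mx (\row_j (j \in Z)%:R).

Lemma restrmxE k n (V : 'M[R]_(k, n)) (Z : {set 'I_n}) i j : restrmx V Z i j = V i j *+ (j \in Z).
Proof. by rewrite /restrmx mul_mx_diag !mxE mulr_natr. Qed.

Lemma projmx_restr0 k n (V : 'M[R]_(k, n)) (Z : {set 'I_n}) i j :
  j \notin Z -> projmx (restrmx V Z) i j = 0.
Proof.
move=> jZ; have /submxP[D ->] := projmx_sub (restrmx V Z).
rewrite mxE big1 // => l _.
by rewrite restrmxE (negPf jZ) mulr0n mulr0.
Qed.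

(** * Leverages and leave-one-out least squares *)

Section Leverage.
Variables (k n : nat) (V : 'M[R]_(k, n)).
Implicit Types (Z : {set 'I_n}) (i j : 'I_n).

(** Adding [i] to [Z] makes the leverage independent of the membership of [i] in [Z]. *)
Definition leverage Z i : R := projmx (restrmx V (i |: Z)) i i.

(** Leave-one-out formula: the weights that predict coordinate [i] by least squares from the other
    coordinates in [Z], when the leverage is below one. *)
Definition predictor Z i j : R :=
  if j == i then 0 else projmx (restrmx V (i |: Z)) i j / (1 - leverage Z i).

Lemma leverage_ge0 Z i : 0 <= leverage Z i.
Proof. by rewrite /leverage projmx_diag sumr_ge0 // => j _; rewrite sqr_ge0. Qed.

Lemma leverage_setU1 Z i : leverage (i |: Z) i = leverage Z i.
Proof. by rewrite /leverage setUA setUid. Qed.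

(** The trace of a projector is its rank, and its diagonal entries outside [Z] are nonnegative. *)
Lemma sum_leverage Z : \sum_(i in Z) leverage Z i <= (\rank V)%:R.
Proof.
have -> : \sum_(i in Z) leverage Z i = \sum_(i in Z) projmx (restrmx V Z) i i.
  by apply: eq_bigr => i iZ; rewrite /leverage (setUidPr _) // sub1set.
apply: le_trans (_ : (\rank (restrmx V Z))%:R <= _); last first.
  by rewrite ler_nat mxrankM_maxl.
rewrite -mxtrace_projmx /mxtrace [leRHS](bigID (mem Z)) /= lerDl sumr_ge0 // => i _.
by rewrite projmx_diag sumr_ge0 // => j _; rewrite sqr_ge0.
Qed.

Lemma predictor_out Z i j : j \notin Z -> predictor Z i j = 0.
Proof.
rewrite /predictor; case: eqVneq => // ji jZ.
by rewrite projmx_restr0 ?mul0r // in_setU1 negb_or ji.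
Qed.

(** The restriction of [v] to [i |: Z] is fixed by the projector; its equation at [i] is solved for
    [v 0 i]. *)
Lemma predictorE Z i (v : 'rV[R]_n) : leverage Z i < 1 -> (v <= V)%MS ->
  \sum_j predictor Z i j * v 0 j = v 0 i.
Proof.
move=> h1 vV; set P := projmx (restrmx V (i |: Z)).
pose w := v *m diag_mx (\row_j (j \in i |: Z)%:R).
have wE j : w 0 j = v 0 j *+ (j \in i |: Z) by rewrite /w mul_mx_diag !mxE mulr_natr.
have wi : w 0 i = v 0 i by rewrite wE setU11.
have wV : (w <= restrmx V (i |: Z))%MS by apply: submxMr.
have := projmx_id wV => /matrixP/(_ 0 i); rewrite wi mxE (bigD1 i) //=.
rewrite wi -/(leverage Z i) => e.
rewrite (bigD1 i) //= {1}/predictor eqxx mul0r add0r.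
have d0 : 1 - leverage Z i != 0 by rewrite gt_eqF // subr_gt0.
apply: (mulfI d0); rewrite mulr_sumr.
transitivity (\sum_(j | j != i) w 0 j * P j i); last first.
  by rewrite mulrBl mul1r -[X in X - _]e [leverage Z i * _]mulrC addrAC subrr add0r.
apply: eq_bigr => j ji; rewrite /predictor (negPf ji) mulrA mulrCA divff // mulr1.
rewrite -{1}projmx_sym mxE -/P mulrC wE.
have [jZ|jZ] := boolP (j \in i |: Z); first by rewrite mulr1n.
by rewrite mulr0n mul0r -[P]projmx_sym mxE projmx_restr0 // mulr0.
Qed.

(** By idempotence the squared row [i] of the projector sums to the leverage [h], so the left side
    is [(h - h ^ 2) / (1 - h) ^ 2 = h / (1 - h)]. *)
Lemma predictor_sqr Z i : leverage Z i <= 2^-1 ->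
  \sum_j predictor Z i j ^+ 2 <= 2 * leverage Z i.
Proof.
move=> h; have h0 := leverage_ge0 Z i.
have := projmx_diag (restrmx V (i |: Z)) i; rewrite -/(leverage Z i).
rewrite (bigD1 i) //= -/(leverage Z i) => e.
rewrite (bigD1 i) //= {1}/predictor eqxx expr0n add0r.
have -> : \sum_(j | j != i) predictor Z i j ^+ 2
  = (leverage Z i - leverage Z i ^+ 2) / (1 - leverage Z i) ^+ 2.
  rewrite {1}e [X in _ = X / _]addrAC subrr add0r mulr_suml.
  by apply: eq_bigr => j ji; rewrite /predictor (negPf ji) expr_div_n.
move: (leverage Z i) h h0 => x h h0.
have : 0 <= x * (1 - x) * (1 - 2 * x) by rewrite !mulr_ge0 //; lra.
by rewrite ler_pdivrMr ?exprn_gt0; lra.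
Qed.

End Leverage.
End OrthogonalProjection.

(** * Counting threshold patterns *)

Section Shatter.
Variable T : finType.
Implicit Types (F G : {set {set T}}) (A X : {set T}).

Definition shatters F A := [forall (X : {set T} | X \subset A), [exists (Y | Y \in F), A :&: Y == X]].

Lemma shattersP F A :
  reflect (forall X, X \subset A -> exists2 Y, Y \in F & A :&: Y = X) (shatters F A).
Proof.
apply: (iffP forall_inP) => h X XA.
  by have /exists_inP[Y YF /eqP] := h X XA; exists Y.
by have [Y YF /eqP e] := h X XA; apply/exists_inP; exists Y.
Qed.

(* Pajor's strengthening of the Sauer-Shelah lemma *)
Lemma card_shattered F : (#|F| <= #|[set A | shatters F A]|)%N.
Proof.
have [m] := ubnP #|F|; elim: m => // m IH in F *; rewrite ltnS => Fm.
have [F0|Fn0] := posnP #|F|; first by rewrite F0.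
have [F1|F2] := leqP #|F| 1.
  have /card_gt0P[Y YF] := Fn0.
  apply: leq_trans F1 _; apply/card_gt0P; exists set0; rewrite inE.
  by apply/shattersP=> X; rewrite subset0 => /eqP ->; exists Y; rewrite // set0I.
have /card_gt1P[X [Y [XF YF XY]]] := F2.
have [x xXY] : exists x, (x \in X) != (x \in Y).
  apply/existsP; apply: contraNT XY => /existsPn h; apply/eqP/setP=> x.
  by have := h x; rewrite negbK => /eqP.
(* Since two members of [F] differ at [x], both halves are nonempty and hence smaller than [F]. *)
pose F1 := [set Z in F | x \in Z]; pose F0 := [set Z in F | x \notin Z].
have FU : #|F| = (#|F1| + #|F0|)%N.
  rewrite -(cardsID [set Z : {set T} | x \in Z] F); congr addn.
    by apply: eq_card => Z; rewrite !inE.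
  by apply: eq_card => Z; rewrite !inE andbC.
have [F1p F0p] : (0 < #|F1|)%N /\ (0 < #|F0|)%N.
  split; apply/card_gt0P; case xX : (x \in X) xXY; case xY : (x \in Y) => // _.
  - by exists X; rewrite inE XF xX.
  - by exists Y; rewrite inE YF xY.
  - by exists Y; rewrite inE YF xY.
  - by exists X; rewrite inE XF xX.
have IH1 := IH F1 ltac:(lia); have IH0 := IH F0 ltac:(lia).
set S1 := [set A | shatters F1 A] in IH1; set S0 := [set A | shatters F0 A] in IH0.
have nx A : A \in S1 :|: S0 -> x \notin A.
  rewrite !inE => /orP[] /shattersP h; apply/negP => xA.
    have [Z] := h set0 (sub0set _); rewrite inE => /andP[_ xZ] /setP/(_ x).
    by rewrite !inE xA xZ.
  have [Z] := h [set x] ltac:(by rewrite sub1set); rewrite inE => /andP[_ xZ] /setP/(_ x).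
  by rewrite !inE xA eqxx (negPf xZ).
(* A set [A] shattered by both halves is counted a second time as [x |: A], which [F] also shatters;
   no set shattered by one half contains [x]. *)
have disj : [disjoint (S1 :|: S0) & [set x |: A | A in S1 :&: S0]].
  apply/pred0P => A /=; apply/negbTE/negP => /andP[/nx xA /imsetP[A' _ eA]].
  by move: xA; rewrite eA setU11.
have card_im : #|[set x |: A | A in S1 :&: S0]| = #|S1 :&: S0|.
  apply: card_in_imset => A A' hA hA' e.
  have xA : x \notin A by apply: nx; move: hA; rewrite !inE => /andP[->].
  have xA' : x \notin A' by apply: nx; move: hA'; rewrite !inE => /andP[->].
  by rewrite -(setU1K xA) -(setU1K xA') e.
rewrite FU; apply: leq_trans (leq_add IH1 IH0) _.
rewrite -cardsUI -card_im.
have -> : (#|S1 :|: S0| + #|[set x |: A | A in S1 :&: S0]|)%N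
  = #|(S1 :|: S0) :|: [set x |: A | A in S1 :&: S0]|.
  by rewrite -(cardsUI _ [set x |: A | A in _]) (disjoint_setI0 disj) cards0 addn0.
apply: subset_leq_card; apply/subsetP => A; rewrite !inE.
have mono G : G \subset F -> shatters G A -> shatters F A.
  move=> /subsetP GF /shattersP h; apply/shattersP => Z /h[Y' /GF YF' eY].
  by exists Y'.
case/orP=> [/orP[]|/imsetP[A' + eA]].
- by apply: mono; apply/subsetP => Z; rewrite inE => /andP[].
- by apply: mono; apply/subsetP => Z; rewrite inE => /andP[].
move=> hA'; have xA' : x \notin A' by apply: nx; move: hA'; rewrite !inE => /andP[->].
move: hA'; rewrite !inE => /andP[/shattersP h1 /shattersP h0].
rewrite eA; apply/shattersP => Z ZA.
have Z'A : Z :\ x \subset A' by rewrite subDset.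
have [xZ|xZ] := boolP (x \in Z).
  have [Y'] := h1 _ Z'A; rewrite inE => /andP[YF' xY'] e.
  by exists Y' => //; rewrite setIUl e (setIidPl _) ?sub1set // setD1K.
have [Y'] := h0 _ Z'A; rewrite inE => /andP[YF' xY'] e.
exists Y' => //; rewrite setIUl e.
have -> : [set x] :&: Y' = set0.
  by apply/setP => y; rewrite !inE; case: eqVneq => // ->; rewrite (negPf xY').
by rewrite set0U; apply/setDidPl; rewrite disjoint_sym disjoints1.
Qed.

Lemma sum_subset_exp (R : comPzRingType) (B : {set T}) (x : R) :
  \sum_(A : {set T} | A \subset B) x ^+ #|A| = (1 + x) ^+ #|B|.
Proof.
have := @bigA_distr R 0 1 *%R +%R T (fun i => if i \in B then x else 0) (fun=> 1).
have -> : \prod_i ((if i \in B then x else 0) + 1) = (1 + x) ^+ #|B|.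
  rewrite -prodr_const [RHS]big_mkcond; apply: eq_bigr => i _.
  by case: (i \in B); rewrite ?add0r // addrC.
move=> ->; rewrite [LHS]big_mkcond; apply: eq_bigr => A _.
have [AB|/subsetPn[i iA iB]] := boolP (A \subset B); last first.
  by rewrite (bigD1 i) //= iA (negPf iB) mul0r.
rewrite -prodr_const [LHS]big_mkcond; apply: eq_bigr => i _.
by have [iA|//] := boolP (i \in A); rewrite (subsetP AB).
Qed.

(** Every shattered set weighs at least [x ^+ d] in the expansion of [(1 + x) ^+ #|B|]. A small [x]
    keeps the logarithm of the count below a small multiple of [#|B|] plus a multiple of [d]. *)
Lemma card_shattered_le (R : realFieldType) F (B : {set T}) (d : nat) (x : R) :
  0 < x <= 1 -> (forall Y, Y \in F -> Y \subset B) ->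
  (forall A, shatters F A -> (#|A| <= d)%N) ->
  #|F|%:R <= x^-1 ^+ d * (1 + x) ^+ #|B|.
Proof.
case/andP=> x0 x1 FB Fd.
apply: le_trans (_ : #|[set A | shatters F A]|%:R <= _).
  by rewrite ler_nat card_shattered.
rewrite -sum_subset_exp mulr_sumr -sumr_const.
under eq_bigl do rewrite inE.
rewrite big_mkcond [leRHS]big_mkcond; apply: ler_sum => A _.
have [hA|hA] := boolP (shatters F A); last first.
  by case: ifP => // _; rewrite mulr_ge0 ?exprn_ge0 ?invr_ge0 ?ltW.
have AB : A \subset B.
  have /shattersP/(_ A (subxx A))[Y /FB YB /setIidPl] := hA.
  by move/subset_trans; apply.
rewrite AB exprVn ler_pdivlMl ?exprn_gt0 // mulr1.
by apply: ler_wiXn2l => //; [exact: ltW|exact: Fd].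
Qed.

End Shatter.

(** * Dimension bound for threshold patterns of a linear space *)

Section Thresholds.
Variable R : realFieldType.

Definition threshold_sets k n (V : 'M[R]_(k, n)) (t : R) (B Y : {set 'I_n}) : Prop :=
  exists2 v : 'rV_n, (v <= V)%MS & Y = [set i in B | t <= v 0 i].

(** A larger shattered set would carry a nonzero [c] orthogonal to [V] and to the constants. If [v]
    realises the pattern where [c] is positive, the terms [c i * (v i - t)] are nonnegative with sum
    zero, which forces [c] to vanish. *)
Lemma shatters_threshold k n (V : 'M[R]_(k, n)) t (B : {set 'I_n}) (F : {set {set 'I_n}}) A :
  (forall Y, Y \in F -> threshold_sets V t B Y) ->
  shatters F A -> (#|A| <= (\rank V).+1)%N.
Proof.
move=> FV /shattersP hA; rewrite leqNgt; apply/negP => ltA.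
have AB : A \subset B.
  have [Y /FV[v _ ->] /setIidPl] := hA A (subxx A).
  by move/subset_trans; apply; apply/subsetP => i; rewrite inE => /andP[].
(* The row of ones absorbs the threshold [t] and accounts for the successor in the bound. *)
pose W : 'M[R]_(k + 1, #|A|) := colsub enum_val (col_mx V (const_mx 1 : 'rV_n)).
have rW : (\rank W <= (\rank V).+1)%N.
  have -> : W = col_mx V (const_mx 1 : 'rV_n) *m colsub enum_val 1%:M.
    by rewrite mulmx_colsub mulmx1.
  apply: leq_trans (mxrankM_maxl _ _) _.
  rewrite -addsmxE -[(\rank V).+1]addn1.
  apply: leq_trans (mxrank_adds_leqif _ _).1 _.
  by rewrite leq_add2l rank_leq_row.
have kW : kermx W^T != 0.
  rewrite -mxrank_eq0 mxrank_ker mxrank_tr -lt0n subn_gt0.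
  exact: leq_ltn_trans rW ltA.
pose c := nz_row (kermx W^T).
have c0 : c != 0 by rewrite nz_row_eq0.
have cW : c *m W^T = 0 by apply/sub_kermxP/nz_row_sub.
pose e (i : 'I_#|A|) : 'I_n := enum_val i.
have eA i : e i \in A by apply: enum_valP.
have cM (y : 'rV_(k + 1)) :
    \sum_i c 0 i * (y *m col_mx V (const_mx 1 : 'rV_n)) 0 (e i) = 0.
  have : (y *m W) *m c^T = 0 by rewrite -mulmxA -[W]trmxK -trmx_mul cW trmx0 mulmx0.
  move=> /matrixP/(_ 0 0); rewrite mxE [X in _ = X]mxE => e0; rewrite -[RHS]e0 /W.
  rewrite mulmx_colsub; apply: eq_bigr => i _.
  by rewrite mulrC [c^T _ _]mxE [colsub _ _ _ _]mxE.
have cV (v : 'rV_n) : (v <= V)%MS -> \sum_i c 0 i * v 0 (e i) = 0.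
  move=> /submxP[D ->]; rewrite -[RHS](cM (row_mx D 0)); apply: eq_bigr => i _.
  by rewrite mul_row_col mul0mx addr0.
have c1 : \sum_i c 0 i = 0.
  rewrite -[RHS](cM (row_mx 0 1%:M)); apply: eq_bigr => i _.
  by rewrite mul_row_col mul0mx add0r mul1mx mxE mulr1.
pose X := [set e i | i in [set i | 0 < c 0 i]].
have XA : X \subset A by apply/subsetP => _ /imsetP[i _ ->]; apply: eA.
have [_ /FV[v vV ->] eX] := hA X XA.
have memX i : (t <= v 0 (e i)) = (0 < c 0 i).
  have <- : (e i \in X) = (0 < c 0 i).
    by rewrite mem_imset ?inE //; apply: enum_val_inj.
  by rewrite -eX !inE eA (subsetP AB) ?eA.
have s0 : \sum_i c 0 i * (v 0 (e i) - t) = 0.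
  under eq_bigr do rewrite mulrBr.
  by rewrite sumrB -mulr_suml c1 mul0r subr0 cV.
have term_ge0 i : true -> 0 <= c 0 i * (v 0 (e i) - t).
  have := memX i; case: (ltP 0 (c 0 i)) => hc.
    by move=> h _; apply: mulr_ge0; [exact: ltW|rewrite subr_ge0 h].
  by move=> /negbT; rewrite -ltNge => h _; apply: mulr_le0; rewrite // subr_le0 ltW.
move/eqP: s0; rewrite psumr_eq0 // => /allP h.
have cge0 i : 0 <= c 0 i.
  have := h i; rewrite mem_index_enum => /(_ isT) /implyP/(_ isT).
  rewrite mulf_eq0 subr_eq0 => /orP[/eqP -> //|/eqP e0].
  by rewrite ltW // -memX e0.
move/eqP: c1; rewrite psumr_eq0 // => /allP h1.
move/eqP: c0; apply; apply/rowP => i; rewrite mxE; apply/eqP.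
by have := h1 i; rewrite mem_index_enum => /(_ isT) /implyP/(_ isT).
Qed.

End Thresholds.

(** * Random subsets *)

Section RandomSubset.
Variables (R : realType) (T : finType).
Implicit Types (p m c : T -> R) (S : {set T}) (i j : T) (f : {set T} -> R).

Definition pr p S : R := \prod_i (if i \in S then p i else 1 - p i).

Definition esp p f : R := \sum_(S : {set T}) pr p S * f S.

Lemma pr_ge0 p S : (forall i, 0 <= p i <= 1) -> 0 <= pr p S.
Proof.
move=> hp; rewrite prodr_ge0 // => i _.
by have /andP[p0 p1] := hp i; case: ifP => _ //; rewrite subr_ge0.
Qed.

Lemma pr_total p : \sum_S pr p S = 1.
Proof.
rewrite -(@bigA_distr R 0 1 *%R +%R T p (fun i => 1 - p i)).
by rewrite big1 // => i _ /=; rewrite addrC subrK.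
Qed.

Lemma esp_cst p a : esp p (fun=> a) = a.
Proof. by rewrite /esp -mulr_suml pr_total mul1r. Qed.

Lemma espD p f g : esp p (fun S => f S + g S) = esp p f + esp p g.
Proof. by rewrite -big_split; apply: eq_bigr => S _; rewrite mulrDr. Qed.

Lemma espZ p a f : esp p (fun S => a * f S) = a * esp p f.
Proof. by rewrite mulr_sumr; apply: eq_bigr => S _; rewrite mulrCA. Qed.

Lemma esp_sum p (I : Type) (r : seq I) (P : pred I) (f : I -> {set T} -> R) :
  esp p (fun S => \sum_(k <- r | P k) f k S) = \sum_(k <- r | P k) esp p (f k).
Proof.
by rewrite /esp [RHS]exchange_big /=; apply: eq_bigr => S _; rewrite mulr_sumr.
Qed.

Lemma eq_esp p f g : f =1 g -> esp p f = esp p g.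
Proof. by move=> fg; apply: eq_bigr => S _; rewrite fg. Qed.

Lemma ler_esp p f g : (forall i, 0 <= p i <= 1) ->
  (forall S, pr p S != 0 -> f S <= g S) -> esp p f <= esp p g.
Proof.
move=> hp fg; apply: ler_sum => S _.
have [->|S0] := eqVneq (pr p S) 0; first by rewrite !mul0r.
by rewrite ler_wpM2l ?fg // pr_ge0.
Qed.

Lemma pr_setU1 p S i : i \notin S -> pr p (i |: S) * (1 - p i) = p i * pr p S.
Proof.
move=> iS; rewrite /pr (bigD1 i) //= [in RHS](bigD1 i) //= setU11 (negPf iS).
rewrite -mulrA [_ * (1 - _)]mulrC; congr (_ * (_ * _)).
by apply: eq_bigr => j ji; rewrite in_setU1 (negPf ji).
Qed.

(** The hypothesis says that [f] ignores the membership of [i]; each [S] without [i] is paired with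
    [i |: S]. *)
Lemma esp_indep p i f : (forall S, f (i |: S) = f S) ->
  esp p (fun S => (i \in S)%:R * f S) = p i * esp p f.
Proof.
move=> fi.
pose A := \sum_(S : {set T} | i \in S) pr p S * f S.
pose B := \sum_(S : {set T} | i \notin S) pr p S * f S.
have hL : esp p (fun S => (i \in S)%:R * f S) = A.
  rewrite /esp /A [RHS]big_mkcond; apply: eq_bigr => S _.
  by case: (i \in S); rewrite ?mul1r ?mul0r ?mulr0.
have hR : esp p f = A + B by rewrite /esp (bigID (fun S => i \in S)).
have hB : p i * B = (1 - p i) * A.
  rewrite /A (reindex_onto (fun S => i |: S) (fun S => S :\ i)) /=; last first.
    by move=> S iS; rewrite setD1K.
  rewrite !mulr_sumr; apply: eq_big => [S|S iS].
    rewrite setU11 /=; apply/idP/eqP => [iS|<-]; first by rewrite setU1K.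
    by rewrite setD11.
  by rewrite fi [RHS]mulrA [(1 - _) * _]mulrC pr_setU1 // mulrA.
by rewrite hL hR mulrDr hB; ring.
Qed.

(** A random subset also encodes a vector of independent signs; inclusion probability
    [(1 + m i) / 2] gives sign mean [m i]. *)
Definition sg S i : R := if i \in S then 1 else - 1.

Lemma sgE S i : sg S i = 2 * (i \in S)%:R - 1.
Proof. by rewrite /sg; case: (i \in S) => /=; lra. Qed.

Lemma esp_sg m i f : (forall S, f (i |: S) = f S) ->
  esp (fun i => (1 + m i) / 2) (fun S => sg S i * f S)
  = m i * esp (fun i => (1 + m i) / 2) f.
Proof.
move=> fi; set p := fun i => _.
rewrite (@eq_esp p _ (fun S => 2 * ((i \in S)%:R * f S) + (- 1) * f S)); last first.
  by move=> S; rewrite sgE; ring.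
by rewrite espD !espZ esp_indep // /p; field.
Qed.

Lemma esp_sg_linear m c :
  esp (fun i => (1 + m i) / 2) (fun S => \sum_j c j * sg S j) = \sum_j c j * m j.
Proof.
rewrite esp_sum; apply: eq_bigr => j _; rewrite espZ; congr (_ * _).
rewrite (@eq_esp _ _ (fun S => sg S j * 1)); last by move=> S; rewrite mulr1.
by rewrite esp_sg // esp_cst mulr1.
Qed.

Lemma esp_sg_center m i f : (forall S, f (i |: S) = f S) ->
  esp (fun i => (1 + m i) / 2) (fun S => (sg S i - m i) * f S) = 0.
Proof.
move=> fi.
rewrite (@eq_esp _ _ (fun S => sg S i * f S + (- m i) * f S)); last by move=> S; ring.
by rewrite espD espZ esp_sg //; ring.
Qed.

Lemma esp_sg_sqr m i :
  esp (fun i => (1 + m i) / 2) (fun S => (sg S i - m i) ^+ 2) = 1 - m i ^+ 2.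
Proof.
rewrite (@eq_esp _ _ (fun S => (- 2 * m i) * ((sg S i - m i) * 1) + (1 - m i ^+ 2))).
  by rewrite espD espZ esp_cst esp_sg_center // mulr0 add0r.
by move=> S; rewrite /sg; case: (i \in S); ring.
Qed.

Lemma esp_sg_variance m c :
  esp (fun i => (1 + m i) / 2) (fun S => (\sum_j c j * (sg S j - m j)) ^+ 2)
  <= \sum_j c j ^+ 2.
Proof.
rewrite (@eq_esp _ _ (fun S => \sum_i \sum_j c i * c j * ((sg S i - m i) * (sg S j - m j)))).
  rewrite esp_sum; apply: ler_sum => i _; rewrite esp_sum (bigD1 i) //= big1 ?addr0.
    rewrite espZ (@eq_esp _ _ (fun S => (sg S i - m i) ^+ 2)) //.
    rewrite esp_sg_sqr -expr2 ler_piMr ?sqr_ge0 //.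
    by rewrite gerBl sqr_ge0.
  move=> j ji; rewrite espZ esp_sg_center ?mulr0 // => S.
  by rewrite /sg in_setU1 (negPf ji).
move=> S; rewrite expr2 mulr_suml; apply: eq_bigr => i _.
by rewrite mulr_sumr; apply: eq_bigr => j _; ring.
Qed.

Lemma expR_esp p f : (forall i, 0 <= p i <= 1) ->
  expR (esp p f) <= esp p (fun S => expR (f S)).
Proof.
move=> hp; set x := esp p f.
have -> : expR x = esp p (fun S => expR x * (1 + (f S - x))).
  by rewrite espZ !espD !esp_cst subrr addr0 mulr1.
apply: ler_esp => // S _.
rewrite -[in leRHS](subrK x (f S)) expRD mulrC ler_pM2r ?expR_gt0 //.
exact: expR_ge1Dx.
Qed.

(* Change of measure: [kl (Rademacher with mean m) (fair sign) <= m ^ 2] *)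
Lemma esp_fair_ge m f : (forall i, `|m i| <= 1) ->
  expR (esp (fun i => (1 + m i) / 2) f - \sum_i m i ^+ 2)
  <= esp (fun=> 2^-1) (fun S => expR (f S)).
Proof.
move=> hm; set p := fun i => (1 + m i) / 2.
have hp i : 0 <= p i <= 1.
  by have := hm i; rewrite ler_norml /p => /andP[m0 m1]; apply/andP; split; lra.
have -> : \sum_i m i ^+ 2 = esp p (fun S => \sum_i m i * sg S i).
  by rewrite esp_sg_linear; apply: eq_bigr => i _; rewrite expr2.
rewrite (_ : _ - _ = esp p (fun S => f S - \sum_i m i * sg S i)); last first.
  rewrite (@eq_esp p (fun S => f S - _) (fun S => f S + (- 1) * \sum_i m i * sg S i)).
    by rewrite espD espZ mulN1r.
  by move=> S; rewrite mulN1r.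
apply: le_trans (expR_esp _ hp) _.
apply: ler_sum => S _; rewrite expRD mulrCA [leRHS]mulrC.
rewrite ler_pM2l ?expR_gt0 // -sumrN expR_sum -big_split /=.
apply: ler_prod => i _; apply/andP; split.
  rewrite mulr_ge0 ?expR_ge0 //; have := hp i; case: ifP => _; rewrite /p; lra.
(* Tilted weight times [expR (- m i * sg R S i)] is at most the fair weight, because
   [1 + x <= expR x]. *)
have key (x : R) : (1 + x) / 2 * expR (- x) <= 2^-1.
  rewrite expRN ler_pdivrMr ?expR_gt0 //; have := expR_ge1Dx x; lra.
rewrite /sg; case: ifP => _; first by rewrite mulr1; exact: key.
have := key (- m i); rewrite mulrN1 /p; set E := expR _; lra.
Qed.

(** Restricting to the sets that avoid [W] costs their probability; Jensen's inequality is applied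
    under the conditional law. *)
Lemma esp_avoid_ge q (W : {set T}) f : 0 <= q <= 1 ->
  (1 - q) ^+ #|W| * expR (esp (fun i => if i \in W then 0 else q) f)
  <= esp (fun=> q) (fun S => expR (f S)).
Proof.
move=> /andP[q0 q1]; set p := fun i => _.
have hp i : 0 <= p i <= 1 by rewrite /p; case: ifP => _; rewrite ?lexx ?ler01 ?q0.
apply: le_trans (_ : (1 - q) ^+ #|W| * esp p (fun S => expR (f S)) <= _).
  by rewrite ler_wpM2l ?exprn_ge0 ?subr_ge0 // expR_esp.
rewrite mulr_sumr; apply: ler_sum => S _.
rewrite mulrA ler_pM2r ?expR_gt0 //.
rewrite -prodr_const big_mkcond -big_split /=.
apply: ler_prod => i _; rewrite /p.
by case: (i \in W) (i \in S) => -[]; lra.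
Qed.

Lemma pr_avoid q (W S : {set T}) :
  pr (fun i => if i \in W then 0 else q) S != 0 -> [disjoint S & W].
Proof.
move=> S0; apply/pred0P => i /=; apply/negbTE/negP => /andP[iS iW].
by move/negP: S0; apply; rewrite /pr (bigD1 i) //= iS iW mul0r.
Qed.

End RandomSubset.

(** * A mixture dominating all likelihood ratios *)

Lemma term_le_double_sum (R : numDomainType) (I : finType) (P : {set I}) (f : I -> I -> R)
    i j : (forall i j, 0 <= f i j) -> i \in P -> j \in P ->
  f i j <= \sum_(i in P) \sum_(j in P) f i j.
Proof.
move=> f0 iP jP; rewrite (bigD1 i) //= (bigD1 j) //= -addrA lerDl.
by rewrite addr_ge0 ?sumr_ge0 // => l _; rewrite sumr_ge0.
Qed.

Section Mixture.
Variables (R : realType) (n k : nat) (V : 'M[R]_(k, n)) (a : 'I_n -> R).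
Variables (kap t eta q : R).
Implicit Types (Z S A : {set 'I_n}) (y : outcome n) (v : 'rV[R]_n).

Definition unstable Z : {set 'I_n} := [set i | eta < leverage V Z i].

Definition patterns Z : {set {set 'I_n}} :=
  [set A | `[< threshold_sets V t (unstable Z) A >]].

(** On unstable points [A] is the guess for the large positive values and [A'] for the large
    negative ones. Elsewhere the factor [2 * kap * t] turns sign means [v 0 j / (2 * t)] into the
    prediction [kap * v 0 i]. *)
Definition candidate Z S A A' i : R :=
  if i \in unstable Z then kap * t * ((i \in A)%:R - (i \in A')%:R)
  else 2 * kap * t * \sum_j predictor V Z i j * sg R S j.

Definition lr y (u : 'I_n -> R) : R := \sum_i llr (a i) (y i) (u i).

Definition mixture y : R :=
  esp (fun=> q) (fun Z => esp (fun=> 2^-1) (fun S =>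
    \sum_(A in patterns Z) \sum_(A' in patterns Z)
      #|patterns Z|%:R^-1 ^+ 2 * expR (lr y (candidate Z S A A')))).

Definition pr0 y : R := \prod_i (if y i then sigmoid (a i) else 1 - sigmoid (a i)).

Lemma lr_mean u : \sum_y pr0 y * expR (lr y u) = 1.
Proof.
transitivity (\sum_(y : {ffun 'I_n -> bool}) \prod_i
   ((if y i then sigmoid (a i) else 1 - sigmoid (a i)) * expR (llr (a i) (y i) (u i)))).
  by apply: eq_bigr => y _; rewrite /lr expR_sum -big_split.
rewrite -(bigA_distr_bigA (fun i (b : bool) =>
  (if b then sigmoid (a i) else 1 - sigmoid (a i)) * expR (llr (a i) b (u i)))) /=.
rewrite big1 // => i _; rewrite big_bool /=; exact: expR_llr_mean.
Qed.

Lemma mixture_mean : 0 <= q <= 1 -> \sum_y pr0 y * mixture y <= 1.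
Proof.
move=> hq; rewrite /mixture.
under eq_bigr do rewrite -espZ; rewrite -esp_sum.
apply: le_trans (_ : esp (fun=> q) (fun=> 1) <= _); last by rewrite esp_cst.
apply: ler_esp => // Z _.
under eq_bigr do rewrite -espZ; rewrite -esp_sum.
apply: le_trans (_ : esp (fun=> 2^-1) (fun=> 1) <= _); last by rewrite esp_cst.
apply: ler_esp => [i|S _].
  by rewrite invr_ge0 invf_le1 ?ler0n //= ler1n.
under eq_bigr do rewrite mulr_sumr; rewrite exchange_big /=.
under eq_bigr => A _.
  under eq_bigr do rewrite mulr_sumr; rewrite exchange_big /=.
  under eq_bigr => A' _.
    under eq_bigr do rewrite mulrCA.
    rewrite -mulr_sumr lr_mean mulr1.
    over.
  rewrite sumr_const.
  over.
rewrite sumr_const -mulrnA -[_ *+ (_ * _)]mulr_natr natrM.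
set N : R := #|_|%:R; have [->|N0] := eqVneq N 0; first by rewrite mul0r mulr0 ler01.
by rewrite -expr2 -exprMn mulVf // expr1n.
Qed.

(** * Lower bound on the mixture for a fixed outcome and a fixed vector *)

Section LowerBound.
Variables (g c4 c5 x : R) (y : outcome n) (v : 'rV[R]_n).
Hypotheses (vV : (v <= V)%MS).
Hypotheses (kap0 : 0 < kap) (t0 : 0 < t) (g0 : 0 < g) (c40 : 0 < c4) (c50 : 0 < c5).
Hypotheses (eta0 : 0 < eta) (eta1 : eta <= 2^-1) (q0 : 0 < q) (q1 : q <= 2^-1).
Hypotheses (x0 : 0 < x) (x1 : x <= 1).
Hypotheses (xg : 8 * x <= g) (qg : 4 * q <= g) (qt : q <= 4 * t ^+ 2 * c4).
Hypothesis (etag : 4 * (2 * kap * t) ^+ 2 * eta <= g / 4).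
Hypothesis scalar : forall i u,
  [/\ `|u| <= t -> kap * llr (a i) (y i) u + c4 * u ^+ 2 <= llr (a i) (y i) (kap * u),
      t <= `|u| -> kap * llr (a i) (y i) u + g <= llr (a i) (y i) (kap * u),
      t <= u -> kap * llr (a i) (y i) u + g <= llr (a i) (y i) (kap * t),
      u <= - t -> kap * llr (a i) (y i) u + g <= llr (a i) (y i) (- (kap * t))
    & kap * llr (a i) (y i) u <= c5].

Let W : {set 'I_n} := [set i | t <= `|v 0 i|].
Let tilt Z i : R := if (i \in Z) && (i \notin W) then v 0 i / (2 * t) else 0.
Let Apos Z : {set 'I_n} := [set i in unstable Z | t <= v 0 i].
Let Aneg Z : {set 'I_n} := [set i in unstable Z | t <= (- v) 0 i].
(** The first term is the prediction variance at stable points; the second charges the loss at an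
    unstable point to its leverage, which exceeds [eta]. *)
Let C6 : R := 4 * (2 * kap * t) ^+ 2 + (c5 + c4 * t ^+ 2) / eta.

Let ltW_t i : i \notin W -> `|v 0 i| < t.
Proof. by rewrite inE -ltNge. Qed.

Ltac slra :=
  move: kap0 t0 g0 c40 c50 eta0 eta1 q0 q1 x0 x1 xg qg qt etag; lra.

Lemma tilt_le1 Z i : `|tilt Z i| <= 1.
Proof.
rewrite /tilt; case: ifP => [/andP[_ /ltW_t h]|_]; last by rewrite normr0 ler01.
rewrite normrM normfV ler_pdivrMr; last by rewrite normr_gt0 gt_eqF ?mulr_gt0.
have t2 : t <= 2 * t by slra.
by rewrite mul1r [leRHS]ger0_norm ?(le_trans (ltW h)) // (le_trans (ltW t0)).
Qed.

(** Least squares reproduces vectors of the space, so the tilted prediction has mean [kap * v 0 i].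
    The first-order term of the expansion vanishes and the second is a variance of at most twice the
    leverage, up to scale. *)
Lemma esp_llr_stable Z i : [disjoint Z & W] -> i \notin unstable Z ->
  llr (a i) (y i) (kap * v 0 i) - 4 * (2 * kap * t) ^+ 2 * leverage V Z i
  <= esp (fun j => (1 + tilt Z j) / 2)
       (fun S => llr (a i) (y i) (2 * kap * t * \sum_j predictor V Z i j * sg R S j)).
Proof.
move=> ZW; rewrite inE -leNgt => lev.
set p := (X in esp X _); set b := 2 * kap * t.
have hp j : 0 <= p j <= 1.
  by have := tilt_le1 Z j; rewrite ler_norml /p => /andP[m0 m1]; apply/andP; split; slra.
pose d S := \sum_j predictor V Z i j * (sg R S j - tilt Z j).
have mean : b * \sum_j predictor V Z i j * tilt Z j = kap * v 0 i.
  transitivity (b * (v 0 i / (2 * t))); last first.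
    by rewrite /b; field; rewrite gt_eqF.
  congr (_ * _); have lev1 : leverage V Z i < 1 by apply: le_lt_trans (le_trans lev eta1) _; slra.
  rewrite -(predictorE lev1 vV).
  rewrite mulr_suml; apply: eq_bigr => j _; rewrite /tilt.
  have [jZ|jZ] := boolP (j \in Z); last by rewrite predictor_out // !mul0r.
  by rewrite (disjointFr ZW jZ) /= mulrA.
have split_d S : b * (\sum_j predictor V Z i j * sg R S j) = kap * v 0 i + b * d S.
  rewrite -mean -mulrDr -big_split; congr (_ * _); apply: eq_bigr => j _ /=.
  by rewrite -mulrDr addrC subrK.
have d_mean : esp p d = 0.
  rewrite esp_sum big1 // => j _; rewrite espZ.
  rewrite (@eq_esp _ _ _ _ (fun S => (sg R S j - tilt Z j) * 1)); last first.
    by move=> S; rewrite mulr1.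
  by rewrite esp_sg_center // mulr0.
have d_var : esp p (fun S => d S ^+ 2) <= 2 * leverage V Z i.
  apply: le_trans (esp_sg_variance _ _) _.
  exact: predictor_sqr (le_trans lev eta1).
set f := llr (a i) (y i); set D := (y i)%:R - sigmoid (a i + kap * v 0 i).
apply: le_trans (_ : esp p (fun S => f (kap * v 0 i) + ((D * b) * d S + (- 2 * b ^+ 2) * d S ^+ 2)) <= _).
  rewrite espD esp_cst espD !espZ d_mean mulr0 add0r.
  have : b ^+ 2 * esp p (fun S => d S ^+ 2) <= b ^+ 2 * (2 * leverage V Z i).
    by rewrite ler_wpM2l ?sqr_ge0.
  slra.
apply: ler_esp => // S _; rewrite split_d.
have := llr_second_order (a i) (y i) (kap * v 0 i) (b * d S).
by rewrite -/f -/D; slra.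
Qed.

(** On [W], a stable point loses at most [g / 4] to the variance, and an unstable one is predicted
    exactly by the signed threshold. Off [W], an unstable point is predicted by [0], at a bounded
    loss. *)
Lemma esp_llr_candidate Z i : [disjoint Z & W] ->
  kap * llr (a i) (y i) (v 0 i) +
    (if i \in W then 3 / 4 * g else c4 * v 0 i ^+ 2 - C6 * leverage V Z i)
  <= esp (fun j => (1 + tilt Z j) / 2)
       (fun S => llr (a i) (y i) (candidate Z S (Apos Z) (Aneg Z) i)).
Proof.
move=> ZW; have [s1 s2 s3 s4 s5] := scalar i (v 0 i).
have l0 := leverage_ge0 V Z i; have c45 : 0 <= c5 + c4 * t ^+ 2 by rewrite addr_ge0 ?mulr_ge0 ?sqr_ge0 // ltW.
have b2 := sqr_ge0 (2 * kap * t).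
rewrite /candidate; have [iB|iB] := boolP (i \in unstable Z); last first.
  apply: le_trans (esp_llr_stable ZW iB).
  case: ifP => [iW|/negbT /ltW_t iW].
    have := s2 ltac:(by move: iW; rewrite inE).
    have : 4 * (2 * kap * t) ^+ 2 * leverage V Z i <= 4 * (2 * kap * t) ^+ 2 * eta.
      apply: ler_wpM2l; first by rewrite pmulr_rge0.
      by move: iB; rewrite inE -leNgt.
    slra.
  have := s1 (ltW iW).
  have : 0 <= (c5 + c4 * t ^+ 2) / eta * leverage V Z i.
    by rewrite mulr_ge0 // divr_ge0 // ltW.
  by rewrite /C6; slra.
rewrite esp_cst !inE; move: (iB); rewrite inE => -> /=; rewrite mxE.
case: ifP => iW.
  have [v0|v0] := leP 0 (v 0 i).
    rewrite ger0_norm // in iW; rewrite iW.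
    have -> : (t <= - v 0 i) = false by apply/negbTE; rewrite -ltNge; slra.
    by rewrite subr0 mulr1; have := s3 iW; slra.
  rewrite ltr0_norm // in iW; rewrite iW.
  have -> : (t <= v 0 i) = false by apply/negbTE; rewrite -ltNge; slra.
  by rewrite sub0r mulrN1; have := s4 ltac:(slra); slra.
have iW' : `|v 0 i| < t by rewrite ltNge iW.
move: (iW'); rewrite ltr_norml => /andP[v1 v2].
have -> : (t <= v 0 i) = false by apply/negbTE; rewrite -ltNge; slra.
have -> : (t <= - v 0 i) = false by apply/negbTE; rewrite -ltNge; slra.
rewrite subrr mulr0 llr0.
have vt : v 0 i ^+ 2 <= t ^+ 2.
  by rewrite -[v 0 i ^+ 2]real_normK ?num_real // lerXn2r ?nnegrE ?normr_ge0 // ltW.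
have h1 : c5 + c4 * t ^+ 2 <= (c5 + c4 * t ^+ 2) / eta * leverage V Z i.
  rewrite mulrAC -mulrA ler_peMr // ler_pdivlMr // mul1r ltW //.
  by move: iB; rewrite inE.
have : c4 * v 0 i ^+ 2 <= c4 * t ^+ 2 by rewrite ler_pM2l.
have : 0 <= 4 * (2 * kap * t) ^+ 2 * leverage V Z i.
  by rewrite mulr_ge0 // pmulr_rge0.
by rewrite /C6; slra.
Qed.

Lemma patterns_pos Z : Apos Z \in patterns Z.
Proof. by rewrite inE; apply/asboolP; exists v. Qed.

Lemma patterns_neg Z : Aneg Z \in patterns Z.
Proof. by rewrite inE; apply/asboolP; exists (- v); rewrite // eqmx_opp. Qed.

(** Unstable points in [W] are charged to [#|W|], and the others to their leverage divided by [eta],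
    which exceeds one. *)
Lemma ln_card_patterns Z :
  ln #|patterns Z|%:R <= (\rank V).+1%:R * ln x^-1
    + x * (#|W|%:R + \sum_(i in ~: W) leverage V Z i / eta).
Proof.
have N0 : 0 < #|patterns Z|%:R :> R.
  by rewrite ltr0n; apply/card_gt0P; exists (Apos Z); apply: patterns_pos.
have bound : #|patterns Z|%:R <= x^-1 ^+ (\rank V).+1 * (1 + x) ^+ #|unstable Z|.
  apply: card_shattered_le; first by rewrite x0.
    move=> A; rewrite inE => /asboolP[u _ ->].
    by apply/subsetP => i; rewrite inE => /andP[].
  move=> A; apply: (@shatters_threshold _ _ _ V t (unstable Z)) => Y.
  by rewrite inE => /asboolP.
have xV : 0 < x^-1 by rewrite invr_gt0.
have x1p : 0 < 1 + x by rewrite addr_gt0.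
apply: le_trans (_ : ln (x^-1 ^+ (\rank V).+1 * (1 + x) ^+ #|unstable Z|) <= _).
  by rewrite ler_ln ?posrE ?mulr_gt0 ?exprn_gt0.
rewrite lnM ?posrE ?exprn_gt0 // !lnXn // -[X in X + _]mulr_natl lerD2l.
rewrite -[leLHS]mulr_natr.
apply: le_trans (_ : x * #|unstable Z|%:R <= _).
  by rewrite ler_wpM2r // -ler_expR lnK ?posrE // expR_ge1Dx.
rewrite ler_pM2l // -(cardsID W) natrD lerD //.
  by rewrite ler_nat subset_leq_card // subsetIr.
rewrite -sum1_card natr_sum [leRHS](bigID (mem (unstable Z))) /=.
rewrite -[leLHS]addr0; apply: lerD; last first.
  by apply: sumr_ge0 => i _; rewrite divr_ge0 ?leverage_ge0 // ltW.
rewrite [leLHS](eq_bigl (fun i => (i \in ~: W) && (i \in unstable Z))); last first.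
  by move=> i; rewrite !inE andbC.
apply: ler_sum => i /andP[_]; rewrite inE => h.
by rewrite ler_pdivlMr // mul1r ltW.
Qed.

Let Psi Z : R := esp (fun j => (1 + tilt Z j) / 2)
    (fun S => lr y (candidate Z S (Apos Z) (Aneg Z)))
  - \sum_i tilt Z i ^+ 2 - 2 * ln #|patterns Z|%:R.

(** The set [Z] is conditioned to avoid [W], the signs are tilted, and only the pair [Apos Z],
    [Aneg Z] is kept from the double sum; the squared number of patterns gives the factor 2 in
    [Psi]. *)
Lemma mixture_ge_Psi :
  (1 - q) ^+ #|W| * expR (esp (fun i => if i \in W then 0 else q) Psi) <= mixture y.
Proof.
have hq : 0 <= q <= 1 by slra.
apply: le_trans (esp_avoid_ge W Psi hq) _.
apply: ler_esp => // Z _; rewrite /Psi expRD.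
set N : R := #|patterns Z|%:R.
have N0 : 0 < N.
  by rewrite ltr0n; apply/card_gt0P; exists (Apos Z); apply: patterns_pos.
have -> : expR (- (2 * ln N)) = N^-1 ^+ 2.
  by rewrite expRN expr2 -invfM mulr_natl mulr2n expRD lnK.
apply: le_trans (_ : esp (fun=> 2^-1) (fun S => expR (lr y (candidate Z S (Apos Z) (Aneg Z))))
   * N^-1 ^+ 2 <= _).
  by rewrite ler_wpM2r ?sqr_ge0 // esp_fair_ge // => i; exact: tilt_le1.
rewrite mulrC -espZ; apply: ler_esp => [i|S _].
  by rewrite invr_ge0 invf_le1 ?ler0n //= ler1n.
have t_ge0 (A A' : {set 'I_n}) : 0 <= N^-1 ^+ 2 * expR (lr y (candidate Z S A A')).
  by rewrite mulr_ge0 ?sqr_ge0 ?expR_ge0.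
exact: (term_le_double_sum t_ge0 (patterns_pos Z) (patterns_neg Z)).
Qed.

Let C8 : R := C6 + 2 * x / eta.

Lemma Psi_ge Z : [disjoint Z & W] ->
  kap * lr y (v 0) + g / 2 * #|W|%:R
  + \sum_(i in ~: W) (c4 * v 0 i ^+ 2 - (i \in Z)%:R * (v 0 i ^+ 2 / (4 * t ^+ 2))
                      - C8 * leverage V Z i)
  - 2 * ((\rank V).+1%:R * ln x^-1) <= Psi Z.
Proof.
move=> ZW; rewrite /Psi /lr esp_sum.
have h1 : \sum_i (kap * llr (a i) (y i) (v 0 i) +
    (if i \in W then 3 / 4 * g else c4 * v 0 i ^+ 2 - C6 * leverage V Z i))
  <= \sum_i esp (fun j => (1 + tilt Z j) / 2)
       (fun S => llr (a i) (y i) (candidate Z S (Apos Z) (Aneg Z) i)).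
  by apply: ler_sum => i _; apply: esp_llr_candidate.
have h2 := ln_card_patterns Z.
have h3 : \sum_i tilt Z i ^+ 2
    = \sum_(i in ~: W) (i \in Z)%:R * (v 0 i ^+ 2 / (4 * t ^+ 2)).
  rewrite [RHS]big_mkcond; apply: eq_bigr => i _; rewrite in_setC /tilt.
  case: (i \in W); rewrite /= ?andbF ?andbT ?expr0n //.
  case: (i \in Z); rewrite ?expr0n /= ?mul0r // mul1r.
  by field; rewrite gt_eqF.
rewrite h3.
have h4 : \sum_i (if i \in W then 3 / 4 * g else c4 * v 0 i ^+ 2 - C6 * leverage V Z i)
    = 3 / 4 * g * #|W|%:R + \sum_(i in ~: W) (c4 * v 0 i ^+ 2 - C6 * leverage V Z i).
  rewrite (bigID (mem W)) /=; congr (_ + _).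
    by rewrite (eq_bigr (fun=> 3 / 4 * g)) ?sumr_const ?mulr_natr // => i ->.
  by apply: eq_big => [i|i /negPf ->]; rewrite ?in_setC.
move: h1; rewrite big_split /= -mulr_sumr h4.
rewrite !sumrB -!mulr_sumr.
move: h2; rewrite -mulr_suml.
set l := \sum_(i in ~: W) leverage V Z i; set w := #|W|%:R.
have w0 : 0 <= w by rewrite ler0n.
(* Guessing the two patterns takes at most [g / 4] per point of [W], which leaves [g / 2] out of
   [3 / 4 * g]. *)
have : 8 * x * w <= g * w by rewrite ler_wpM2r.
rewrite /C8; move: (ln _) (ln _) => X Y.
have -> : (C6 + 2 * x / eta) * l = C6 * l + 2 * (x * (l / eta)) by field; rewrite gt_eqF.
set E := \sum_i esp _ _.
slra.
Qed.

Lemma mixture_ge :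
  expR (kap * lr y (v 0)
        - (C8 / q + 2 * ln x^-1) * ((\rank V)%:R + 1)) <= mixture y.
Proof.
apply: le_trans mixture_ge_Psi.
set p := (X in esp X _).
have hp i : 0 <= p i <= 1 by rewrite /p; case: ifP => _; slra.
have C80 : 0 <= C8.
  rewrite /C8 /C6 !addr_ge0 ?mulr_ge0 ?invr_ge0 ?addr_ge0 ?mulr_ge0 ?sqr_ge0 //; exact: ltW.
have lx : 0 <= ln x^-1 by rewrite ln_ge0 // invf_ge1.
(* Independence turns the mean leverage into [q^-1] times its mean over members of [Z], where
   [sum_leverage] applies. *)
have lev i : i \in ~: W -> esp p (fun Z => leverage V Z i)
    = q^-1 * esp p (fun Z => (i \in Z)%:R * leverage V Z i).
  rewrite in_setC => iW; rewrite esp_indep => [|Z]; last exact: leverage_setU1.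
  by rewrite /p (negPf iW) mulKf // gt_eqF.
have mem i : i \in ~: W -> esp p (fun Z => (i \in Z)%:R) = q.
  rewrite in_setC => iW.
  rewrite (@eq_esp _ _ _ _ (fun Z => (i \in Z)%:R * 1)); last by move=> Z; rewrite mulr1.
  by rewrite esp_indep // esp_cst /p (negPf iW) mulr1.
have h1 : kap * lr y (v 0) + g / 2 * #|W|%:R
     - C8 / q * (\rank V)%:R - 2 * ((\rank V).+1%:R * ln x^-1) <= esp p Psi.
  apply: le_trans (_ : esp p (fun Z => (kap * lr y (v 0) + g / 2 * #|W|%:R
      - 2 * ((\rank V).+1%:R * ln x^-1))
      + \sum_(i in ~: W) (c4 * v 0 i ^+ 2 + ((- (v 0 i ^+ 2 / (4 * t ^+ 2))) * (i \in Z)%:R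
                      + (- C8) * leverage V Z i))) <= _); last first.
    apply: ler_esp => // Z /pr_avoid ZW; apply: le_trans (Psi_ge ZW).
    rewrite [leRHS]addrAC lerD2l; apply: ler_sum => i _.
    by rewrite mulNr [_ * (i \in Z)%:R]mulrC mulNr addrA.
  rewrite espD esp_cst esp_sum [leLHS]addrAC lerD2l.
  apply: le_trans (_ : \sum_(i in ~: W) - (C8 / q) * esp p (fun Z => (i \in Z)%:R * leverage V Z i) <= _).
    rewrite -mulr_sumr -esp_sum mulNr lerN2.
    apply: ler_wpM2l; first by rewrite divr_ge0 // ltW.
    rewrite -[leRHS](esp_cst p); apply: ler_esp => // Z _.
    apply: le_trans (sum_leverage V Z).
    rewrite big_mkcond [leRHS]big_mkcond; apply: ler_sum => i _.
    have := leverage_ge0 V Z i.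
    by case: (i \in ~: W); case: (i \in Z); rewrite /= ?mul1r ?mul0r.
  apply: ler_sum => i iW.
  rewrite !espD esp_cst !espZ mem // lev //.
  (* A point is tilted with probability [q] only, so the quadratic gain pays for the tilt. *)
  have hv : q * (v 0 i ^+ 2 / (4 * t ^+ 2)) <= c4 * v 0 i ^+ 2.
    rewrite mulrCA mulrC ler_wpM2r ?sqr_ge0 // ler_pdivrMr ?mulr_gt0 ?exprn_gt0 //; slra.
  by rewrite mulrA mulNr; slra.
(* The gain [g / 2] left at each point of [W] pays for avoiding [W]. *)
have h2 : expR (- (g / 2 * #|W|%:R)) <= (1 - q) ^+ #|W|.
  rewrite -mulNr mulrC expRM_natl; apply: lerXn2r; rewrite ?nnegrE ?expR_ge0 //.
    by slra.
  rewrite expRN invf_ple ?posrE ?expR_gt0 //; last by slra.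
  apply: le_trans (expR_ge1Dx _).
  have q1' : 0 < 1 - q by slra.
  rewrite -(ler_pM2l q1') divff ?gt_eqF //.
  have : 0 <= (2^-1 - q) * g by rewrite mulr_ge0 ?subr_ge0 // ltW.
  slra.
apply: le_trans (_ : expR (- (g / 2 * #|W|%:R)) * expR (esp p Psi) <= _); last first.
  by rewrite ler_wpM2r // expR_ge0.
rewrite -expRD ler_expR.
move: h1; rewrite -natr1.
have : 0 <= C8 / q by rewrite divr_ge0 // ltW.
by move: (C8 / q) (ln _) => X Y; slra.
Qed.

End LowerBound.
End Mixture.

(** As [Q] does not depend on [v], the bound holds simultaneously over the space, at data-dependent
    [v] in particular; [kap] and [C] are fixed by [c] before the design. *)
Lemma lr_domination (R : realType) (c : R) : 0 < c ->
  exists kap C : R, [/\ 0 < kap, 0 < C &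
  forall n k (V : 'M[R]_(k, n)) (a : 'I_n -> R), (forall i, `|a i| <= c) ->
  exists Q : outcome n -> R, [/\ forall y, 0 < Q y,
    \sum_y pr0 a y * Q y <= 1 &
    forall y (v : 'rV_n), (v <= V)%MS ->
      kap * lr a y (v 0) <= ln (Q y) + C * ((\rank V)%:R + 1)]].
Proof.
move=> c0; have [kap [t [g [c4 [c5 [[k0 t0 g0 c40 c50] scalar]]]]]] := llr_constants c0.
pose x := Num.min 1 (g / 8).
pose eta := Num.min 2^-1 (g / 16 / (2 * kap * t) ^+ 2).
pose q := Num.min (Num.min 2^-1 (g / 4)) (4 * t ^+ 2 * c4).
have b0 : 0 < (2 * kap * t) ^+ 2 by rewrite exprn_gt0 // !mulr_gt0.
have x0 : 0 < x by rewrite /x lt_min ltr01 divr_gt0.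
have x1 : x <= 1 by rewrite /x ge_min lexx.
have xg : 8 * x <= g.
  have : x <= g / 8 by rewrite /x ge_min lexx orbT.
  lra.
have eta0 : 0 < eta by rewrite /eta lt_min invr_gt0 ltr0n /= !divr_gt0.
have eta1 : eta <= 2^-1 by rewrite ge_min lexx.
have etag : 4 * (2 * kap * t) ^+ 2 * eta <= g / 4.
  have : eta <= g / 16 / (2 * kap * t) ^+ 2 by rewrite /eta ge_min lexx orbT.
  by rewrite ler_pdivlMr //; lra.
have q0 : 0 < q by rewrite !lt_min invr_gt0 ltr0n divr_gt0 // !mulr_gt0 // exprn_gt0.
have q1 : q <= 2^-1 by rewrite !ge_min lexx.
have qg : 4 * q <= g.
  have : q <= g / 4 by rewrite !ge_min lexx orbT.
  lra.
have qt : q <= 4 * t ^+ 2 * c4 by rewrite ge_min lexx orbT.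
set C := (4 * (2 * kap * t) ^+ 2 + (c5 + c4 * t ^+ 2) / eta + 2 * x / eta) / q
   + 2 * ln x^-1.
exists kap, (C + 1).
have C0 : 0 <= C.
  rewrite addr_ge0 //; last by rewrite mulr_ge0 // ln_ge0 // invf_ge1.
  rewrite divr_ge0 ?ltW // !addr_gt0 //; first by rewrite mulr_gt0.
    by rewrite divr_gt0 // addr_gt0 // mulr_gt0 // exprn_gt0.
  by rewrite divr_gt0 // mulr_gt0.
split=> //; first by lra.
move=> n k V a ha; exists (mixture V a kap t eta q).
have main y v (vV : (v <= V)%MS) := @mixture_ge R n k V a kap t eta q g c4 c5 x y v vV
  k0 t0 g0 c40 c50 eta0 eta1 q0 q1 x0 x1 xg qg qt etag
  (fun i u => scalar (a i) (y i) u (ha i)).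
have Q0 y : 0 < mixture V a kap t eta q y.
  by apply: lt_le_trans (main y 0 (sub0mx _ _)); rewrite expR_gt0.
split=> // [|y v vV]; first by apply: mixture_mean; lra.
have := main y v vV; rewrite -[X in _ <= X -> _]lnK ?posrE ?Q0 // ler_expR -/C.
have : 0 <= (\rank V)%:R + 1 :> R by rewrite addr_ge0.
lra.
Qed.

(** * Risk bounds *)

Section Risk.
Variables (R : realType) (X : Type) (n M : nat) (x : 'I_n -> X) (f0 : X -> R).
Implicit Types (f : X -> R) (y : outcome n).

Definition design f : 'I_n -> R := fun i => f (x i).
Definition deviation f : 'rV[R]_n := \row_i (f (x i) - f0 (x i)).

Lemma ln_sigmoid (z : R) : ln (sigmoid z) = z - softplus z.
Proof.
by rewrite /sigmoid ln_div ?posrE ?expR_gt0 ?onePexp_gt0 // expRK.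
Qed.

Lemma ln_sigmoidC (z : R) : ln (1 - sigmoid z) = - softplus z.
Proof. by rewrite sigmoidC lnV ?posrE ?onePexp_gt0. Qed.

Lemma EfE g : Ef x f0 g = \sum_y pr0 (design f0) y * g y.
Proof. by []. Qed.

Lemma pr0_ge0 (a : 'I_n -> R) y : 0 <= pr0 a y.
Proof.
apply: prodr_ge0 => i _; case: ifP => _; first exact/ltW/sigmoid_gt0.
by rewrite subr_ge0 ltW // sigmoid_lt1.
Qed.

Lemma pr0_total (a : 'I_n -> R) : \sum_y pr0 a y = 1.
Proof.
rewrite -[RHS](lr_mean a (fun=> 0)); apply: eq_bigr => y _.
by rewrite /lr big1 ?expR0 ?mulr1 // => i _; rewrite llr0.
Qed.

Lemma pr0_marginal (a : 'I_n -> R) i : \sum_y pr0 a y * (y i)%:R = sigmoid (a i).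
Proof.
pose w j (b : bool) := (if b then sigmoid (a j) else 1 - sigmoid (a j))
   * (if j == i then b%:R else 1).
transitivity (\sum_(y : {ffun 'I_n -> bool}) \prod_j w j (y j)).
  apply: eq_bigr => y _; rewrite big_split /=; congr (_ * _).
  by rewrite (bigD1 i) //= eqxx big1 ?mulr1 // => j /negPf ->.
rewrite -(bigA_distr_bigA w) (bigD1 i) //= [X in _ * X]big1 => [|j ji].
  by rewrite big_bool /w eqxx /=; ring.
by rewrite big_bool /w (negPf ji) /=; ring.
Qed.

Lemma gamma_nE y f : (0 < n)%N ->
  n%:R * (gamma_n x y f0 - gamma_n x y f) = lr (design f0) y (deviation f 0).
Proof.
move=> n0; rewrite /gamma_n -mulrBr mulVKf ?pnatr_eq0 -?lt0n // -sumrB.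
apply: eq_bigr => i _.
rewrite /llr mxE /design [f0 _ + _]addrC subrK /softplus.
by move: (y i)%:R => Y; ring.
Qed.

Lemma KLE f : (0 < n)%N ->
  n%:R * KL x f0 f = \sum_i bregman (design f0 i) (deviation f 0 i).
Proof.
move=> n0; rewrite /KL mulVKf ?pnatr_eq0 -?lt0n //.
apply: eq_bigr => i _; rewrite /bregman mxE /design [f0 _ + _]addrC subrK.
rewrite -[pi_ f0 _]/(sigmoid (f0 (x i))) -[pi_ f _]/(sigmoid (f (x i))).
rewrite [ln (sigmoid _ / _)]ln_div ?posrE ?sigmoid_gt0 //.
rewrite [ln ((1 - _) / _)]ln_div ?posrE ?subr_gt0 ?sigmoid_lt1 //.
by rewrite !ln_sigmoid !ln_sigmoidC; ring.
Qed.

Lemma sqnormE (f g : X -> R) : (0 < n)%N ->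
  n%:R * sqnorm_n x (fun z => f z - g z) = \sum_i (f (x i) - g (x i)) ^+ 2.
Proof.
by move=> n0; rewrite /sqnorm_n /inner_n mulVKf ?pnatr_eq0 -?lt0n.
Qed.

Lemma lrE (a : 'I_n -> R) y (u : 'I_n -> R) :
  lr a y u = \sum_i ((y i)%:R - sigmoid (a i)) * u i - \sum_i bregman (a i) (u i).
Proof.
rewrite -sumrB; apply: eq_bigr => i _; rewrite /llr /bregman.
by move: (y i)%:R => Y; ring.
Qed.

Lemma lr_expectation (a : 'I_n -> R) (u : 'I_n -> R) :
  \sum_y pr0 a y * lr a y u = - \sum_i bregman (a i) (u i).
Proof.
under eq_bigr do rewrite lrE mulrBr.
rewrite sumrB -mulr_suml pr0_total mul1r -[RHS]add0r; congr (_ - _).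
under eq_bigr do rewrite mulr_sumr.
rewrite exchange_big big1 // => i _ /=.
under eq_bigr do rewrite mulrA mulrBr; rewrite -mulr_suml sumrB -mulr_suml.
by rewrite pr0_marginal pr0_total mul1r subrr mul0r.
Qed.

Variable phi : 'I_M -> X -> R.

Definition model_mx (m : {set 'I_M}) : 'M[R]_(M, n) :=
  \matrix_(j < M, i < n) (if j \in m then phi j (x i) else 0).

(** The vector of [f0] is adjoined since [f0] may lie outside the model; the deviations then belong
    to a linear space. *)
Definition extended_mx (m : {set 'I_M}) : 'M[R]_(M + 1, n) :=
  col_mx (model_mx m) (\row_i f0 (x i)).

Lemma rank_extended m : (\rank (extended_mx m) <= D_ x phi m + 1)%N.
Proof.
rewrite /extended_mx -addsmxE; apply: leq_trans (mxrank_adds_leqif _ _).1 _.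
by rewrite leq_add2l rank_leq_row.
Qed.

Lemma deviation_sub m f : S_ phi m f -> (deviation f <= extended_mx m)%MS.
Proof.
case=> beta ->; apply/submxP; exists (row_mx (\row_j beta j) (- 1%:M)).
rewrite mul_row_col mulNmx mul1mx; apply/rowP => i; rewrite !mxE; congr (_ - _).
rewrite big_mkcond; apply: eq_bigr => j _; rewrite !mxE.
by case: ifP; rewrite ?mulr0.
Qed.

(** The empty model contributes one; additive constants can thus be absorbed into the [Sigma]
    term. *)
Lemma Sigma_ge1 (L : {set 'I_M} -> R) : 1 <= Sigma x phi L.
Proof.
rewrite /Sigma (bigD1 set0) //= (_ : D_ x phi set0 = 0)%N; last first.
  rewrite /D_ (_ : \matrix_(_, _) _ = 0) ?mxrank0 //.
  by apply/matrixP => i j; rewrite !mxE inE.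
by rewrite mulr0 oppr0 expR0 lerDl sumr_ge0 // => m _; rewrite expR_ge0.
Qed.

End Risk.

(* At the deviation shrunk by [s] the quadratic part of the divergence is of order [s ^ 2]
   while the log-likelihood ratio gains order [s]. *)
Lemma bregman_le_lr (R : realType) n (a : 'I_n -> R) (y : outcome n)
    (u : 'I_n -> R) (r s : R) :
  0 < r -> s = r / 4 -> (forall i, r * u i ^+ 2 <= bregman (a i) (u i)) ->
  s * (lr a y u + (\sum_i bregman (a i) (u i)) / 2) <= lr a y (fun i => s * u i).
Proof.
move=> r0 sE hu.
set B := \sum_i bregman _ _.
have hS : r * \sum_i u i ^+ 2 <= B.
  by rewrite mulr_sumr; apply: ler_sum => i _; exact: hu.
have hB : \sum_i bregman (a i) (s * u i) <= 2 * s ^+ 2 * \sum_i u i ^+ 2.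
  rewrite mulr_sumr; apply: ler_sum => i _.
  by have := sp_upper (a i) (s * u i); rewrite /bregman; lra.
rewrite !lrE -/B.
have -> : \sum_i ((y i)%:R - sigmoid (a i)) * (s * u i)
   = s * \sum_i ((y i)%:R - sigmoid (a i)) * u i.
  by rewrite mulr_sumr; apply: eq_bigr => i _; rewrite mulrCA.
have : s * (r * \sum_i u i ^+ 2) <= s * B.
  by rewrite ler_wpM2l // sE; lra.
have -> : s * (r * \sum_i u i ^+ 2) = 4 * s ^+ 2 * \sum_i u i ^+ 2.
  by rewrite sE; field.
lra.
Qed.

(** * Oracle inequalities for the selected estimator *)

Theorem theorem3p1 (R : realType) (c1 : R) (hc1 : 0 < c1) :
  exists lambda : R, 0 < lambda /\
  forall C0 : R, 0 < C0 ->
  exists C C' C1 C1' : R, 0 < C /\ 0 < C' /\ 0 < C1 /\ 0 < C1' /\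
  forall (X : Type) (n M : nat) (x : 'I_n -> X) (f0 : X -> R)
    (phi : 'I_M -> X -> R) (L pen : {set 'I_M} -> R)
    (fhat : {set 'I_M} -> outcome n -> X -> R)
    (fm : {set 'I_M} -> X -> R)
    (mhat : outcome n -> {set 'I_M}),
  (0 < n)%N ->
  (forall i : 'I_n, `|f0 (x i)| <= c1) ->
  orthonormal_n x phi ->
  (* fhat m = argmin of gamma_n over S_m cap L_infty(C0) *)
  (forall m y, S_ phi m (fhat m y) /\ Linf x C0 (fhat m y) /\
     forall t, S_ phi m t -> Linf x C0 t -> gamma_n x y (fhat m y) <= gamma_n x y t) ->
  (* f_m = argmin of gamma over S_m cap L_infty(C0) *)
  (forall m, S_ phi m (fm m) /\ Linf x C0 (fm m) /\
     forall t, S_ phi m t -> Linf x C0 t -> gamma x f0 (fm m) <= gamma x f0 t) ->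
  (forall m, 0 < L m) ->
  (forall m, 0 <= pen m) ->
  (forall m, pen m >= lambda * ((D_ x phi m)%:R / n%:R)
                       * (2^-1 + Num.sqrt (5 * L m)) ^+ 2) ->
  (* mhat = argmin_m { gamma_n(fhat_m) + pen(m) } *)
  (forall y m, gamma_n x y (fhat (mhat y) y) + pen (mhat y)
                 <= gamma_n x y (fhat m y) + pen m) ->
  (forall m,
     Ef x f0 (fun y => KL x f0 (fhat (mhat y) y))
       <= C * (KL x f0 (fm m) + pen m) + C1 * (Sigma x phi L / n%:R)) /\
  (forall m,
     Ef x f0 (fun y => sqnorm_n x (fun z => fhat (mhat y) y z - f0 z))
       <= C' * (sqnorm_n x (fun z => f0 z - fm m z) + pen m)
          + C1' * (Sigma x phi L / n%:R)).
Proof.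
have [kap [K [kap0 K0 dom]]] := lr_domination hc1.
(* Since [(8 * K + 1) * (4^-1 + 5 * L m)] dominates [2 * (K + L m)], half of the penalty pays for
   the complexity of a model. *)
exists ((8 * K + 1) / kap); split.
  by rewrite divr_gt0 // addr_gt0 // mulr_gt0.
move=> C0 hC0.
(* [C0] enters only here, through the curvature of the divergence on deviations bounded by
   [C0 + c1]. *)
pose r : R := (16 * expR (c1 + 2 * (C0 + c1)))^-1.
have r0 : 0 < r by rewrite invr_gt0 mulr_gt0 ?expR_gt0.
pose s := r / 4.
have s0 : 0 < s by rewrite divr_gt0.
pose A := 2 / s + 2; pose A1 := (4 / s + 2) * ((1 + 2 * K) / kap).
have A0 : 0 < A by rewrite addr_gt0 // divr_gt0.
have A10 : 0 < A1.
  by rewrite mulr_gt0 ?divr_gt0 ?addr_gt0 ?divr_gt0 // mulr_gt0.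
exists A, (A * 2 / r + A / r), A1, (A1 / r).
split=> //; split; first by rewrite addr_gt0 // divr_gt0 // mulr_gt0.
split=> //; split; first by rewrite divr_gt0.
move=> X n M x f0 phi L pen fhat fm mhat n0 hf0 _ hfhat hfm hL hpen hpenL hmhat.
set N : R := n%:R; have N0 : 0 < N by rewrite ltr0n.
set a := design x f0; have ha i : `|a i| <= c1 := hf0 i.
have {}dom m := dom n _ (extended_mx x f0 phi m) a ha.
have [Q HQ] := choice dom.
have Q0 m y : 0 < Q m y by have [] := HQ m.
have EQ m : \sum_y pr0 a y * Q m y <= 1 by have [] := HQ m.
have domQ m y (v : 'rV_n) : (v <= extended_mx x f0 phi m)%MS ->
    kap * lr a y (v 0) <= ln (Q m y) + K * ((D_ x phi m)%:R + 2).
  have [_ _ h] := HQ m; move=> hv; apply: le_trans (h y v hv) _.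
  rewrite lerD2l ler_pM2l //; have := rank_extended x f0 phi m.
  rewrite -(ler_nat R) natrD; lra.
set D := fun m => (D_ x phi m)%:R : R.
(* The weighted sum of densities controls all models at once through [ln z <= z], and its mean is at
   most [Sigma]. *)
pose V y := \sum_m Q m y * expR (- (L m * D m)).
have V_ge0 y : 0 <= V y.
  by rewrite sumr_ge0 // => m _; rewrite mulr_ge0 ?expR_ge0 // ltW.
have lnQ m y : ln (Q m y) <= V y + L m * D m.
  rewrite -lerBlDr -[X in X <= _]expRK expRD lnK ?posrE //.
  apply: le_trans (_ : Q m y * expR (- (L m * D m)) <= _).
    set z := _ * _; have z0 : 0 < z by rewrite mulr_gt0 ?expR_gt0.
    by rewrite -ler_expR lnK ?posrE //; have := expR_ge1Dx z; lra.
  by rewrite /V (bigD1 m) //= lerDl sumr_ge0 // => j _; rewrite mulr_ge0 ?expR_ge0 // ltW.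
have EV : \sum_y pr0 a y * V y <= Sigma x phi L.
  rewrite /V; under eq_bigr do rewrite mulr_sumr; rewrite exchange_big /=.
  apply: ler_sum => m _; under eq_bigr do rewrite mulrA; rewrite -mulr_suml.
  by rewrite ler_piMl ?expR_ge0.
have penD m : (K + L m) * D m <= kap * (N * pen m / 2).
  have h : (8 * K + 1) * (D m * (2^-1 + Num.sqrt (5 * L m)) ^+ 2) <= kap * (N * pen m).
    have h := ler_wpM2l (ltW (mulr_gt0 kap0 N0)) (hpenL m).
    rewrite [leRHS]mulrA; apply: le_trans h; rewrite le_eqVlt; apply/orP; left; apply/eqP.
    by rewrite -/(D m) -/N; field; rewrite !gt_eqF.
  have D0 : 0 <= D m by rewrite /D ler0n.
  have h5 : 4^-1 + 5 * L m <= (2^-1 + Num.sqrt (5 * L m)) ^+ 2.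
    have := sqrtr_ge0 (5 * L m); have : 0 <= 5 * L m by rewrite mulr_ge0 // ltW.
    by move=> /sqr_sqrtr; lra.
  have K8 : 0 <= 8 * K + 1 by lra.
  have h6 := ler_wpM2l K8 (ler_wpM2l D0 h5).
  have DL : 0 <= D m * L m by rewrite mulr_ge0 // ltW.
  have : 0 <= K * (D m * L m) by rewrite mulr_ge0 // ltW.
  lra.
pose B y := \sum_i bregman (a i) (deviation x f0 (fhat (mhat y) y) 0 i).
have curv m y i : r * (deviation x f0 (fhat m y) 0 i) ^+ 2
    <= bregman (a i) (deviation x f0 (fhat m y) 0 i).
  have [_ [hinf _]] := hfhat m y.
  have hd : `|deviation x f0 (fhat m y) 0 i| <= C0 + c1.
    by rewrite mxE (le_trans (ler_normB _ _)) // lerD.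
  by have := softplus_quad_lower (ltW hc1) (ha i) hd; rewrite /bregman -/r; lra.
have key m y : B y <= (4 / s + 2) * ((V y + 2 * K) / kap)
     + A * (N * pen m - lr a y (deviation x f0 (fm m) 0)).
  set mh := mhat y; set fh := fhat mh y.
  set vh := deviation x f0 fh; set vm := deviation x f0 (fm m).
  have vhV : (vh <= extended_mx x f0 phi mh)%MS by apply: deviation_sub; case: (hfhat mh y).
  have basic : N * pen mh - lr a y (vh 0) <= N * pen m - lr a y (vm 0).
    rewrite -!gamma_nE // -/N -[N * _ - N * _]mulrBr -[leRHS]mulrBr ler_pM2l //.
    have := hmhat y m; have [Sm [Im _]] := hfm m; have [_ [_ hmin]] := hfhat m y.
    have := hmin _ Sm Im; rewrite -/mh -/fh.
    by move: (gamma_n _ _ _) (gamma_n _ _ _) (gamma_n _ _ _) (gamma_n _ _ _) => *; lra.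
  set U := (V y + 2 * K) / kap; set T := U + N * pen mh / 2.
  have U0 : 0 <= U by rewrite divr_ge0 ?addr_ge0 ?mulr_ge0 // ltW.
  have lrT (v : 'rV_n) : (v <= extended_mx x f0 phi mh)%MS -> lr a y (v 0) <= T.
    move=> hv; rewrite -(ler_pM2l kap0); apply: le_trans (domQ _ _ _ hv) _.
    have -> : kap * T = V y + 2 * K + kap * (N * pen mh / 2).
      by rewrite /T /U; field; rewrite gt_eqF.
    by have := lnQ mh y; have := penD mh; rewrite -/(D mh); lra.
  (* The domination is used twice: at [vh] it bounds the selected penalty, as only half of it is
     spent, and at [s *: vh] it bounds the divergence. *)
  have h1 := lrT vh vhV.
  have h2 := lrT (s *: vh) (scalemx_sub _ vhV).
  have e2 : lr a y ((s *: vh) 0) = lr a y (fun i => s * vh 0 i).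
    by apply: eq_bigr => i _; rewrite mxE.
  rewrite e2 in h2.
  have h3 := @bregman_le_lr R n a y (vh 0) r s r0 erefl (curv mh y).
  rewrite -/(B y) in h3.
  have h4 : lr a y (vh 0) + B y / 2 <= T / s.
    by rewrite ler_pdivlMr // mulrC; apply: le_trans h3 h2.
  have pmh : 0 <= N * pen mh by rewrite mulr_ge0 // ltW.
  set Y := N * pen m - lr a y (vm 0) in basic *.
  have h5 : N * pen mh / 2 <= U + Y by move: h1 basic; rewrite /T; lra.
  have h6 : T / s <= (2 * U + Y) / s.
    by rewrite ler_pM2r ?invr_gt0 // /T; lra.
  have -> : (4 / s + 2) * U + A * Y = 2 * ((2 * U + Y) / s) + 2 * U + 2 * Y.
    by rewrite /A; field; rewrite gt_eqF.
  lra.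
have EB m : \sum_y pr0 a y * B y <= N * (A * (KL x f0 (fm m) + pen m)
     + A1 * (Sigma x phi L / N)).
  apply: le_trans (_ : \sum_y pr0 a y * ((4 / s + 2) / kap * V y
      + ((4 / s + 2) / kap * (2 * K) + A * (N * pen m))
      + (- A) * lr a y (deviation x f0 (fm m) 0)) <= _).
    apply: ler_sum => y _; rewrite ler_wpM2l ?pr0_ge0 //.
    by apply: le_trans (key m y) _; lra.
  under eq_bigr do rewrite !mulrDr [_ * (- A * _)]mulrCA [_ * (_ / kap * V _)]mulrCA -!mulrDr.
  rewrite !big_split /= -!mulr_sumr -mulr_suml pr0_total mul1r lr_expectation -KLE //.
  have S1 := Sigma_ge1 x phi L.
  have c0 : 0 <= (4 / s + 2) / kap.
    by rewrite divr_ge0 ?addr_ge0 ?divr_ge0 // ltW.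
  have := ler_wpM2l c0 EV.
  have : (4 / s + 2) / kap * (2 * K) * 1 <= (4 / s + 2) / kap * (2 * K) * Sigma x phi L.
    by rewrite ler_wpM2l // mulr_ge0 // mulr_ge0 // ltW.
  have -> : N * (A * (KL x f0 (fm m) + pen m) + A1 * (Sigma x phi L / N))
     = A * (N * KL x f0 (fm m)) + A * (N * pen m) + (4 / s + 2) / kap * Sigma x phi L
       + (4 / s + 2) / kap * (2 * K) * Sigma x phi L.
    by rewrite /A1; field; rewrite !gt_eqF.
  lra.
split=> m.
  rewrite EfE -(ler_pM2l N0); apply: le_trans (EB m); rewrite mulr_sumr.
  by apply: ler_sum => y _; rewrite mulrCA KLE.
(* The divergence lies between [r] times and twice the squared norm on the deviations involved,
   which transfers the first bound to the second. *)
have KLfm : KL x f0 (fm m) <= 2 * sqnorm_n x (fun z => f0 z - fm m z).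
  rewrite -(ler_pM2l N0) KLE // mulrCA sqnormE // mulr_sumr.
  apply: ler_sum => i _; rewrite mxE /bregman.
  by have := sp_upper (design x f0 i) (fm m (x i) - f0 (x i)); lra.
rewrite EfE -(ler_pM2l N0).
apply: le_trans (_ : (\sum_y pr0 a y * B y) / r <= _).
  rewrite mulr_sumr mulr_suml; apply: ler_sum => y _.
  rewrite mulrCA -mulrA ler_wpM2l ?pr0_ge0 // ler_pdivlMr // mulrC sqnormE // mulr_sumr.
  by apply: ler_sum => i _; have := curv (mhat y) y i; rewrite !mxE.
rewrite ler_pdivrMr //; apply: le_trans (EB m) _.
rewrite -[leRHS]mulrA ler_pM2l //.
have -> : ((A * 2 / r + A / r) * (sqnorm_n x (fun z => f0 z - fm m z) + pen m)
   + A1 / r * (Sigma x phi L / N)) * r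
  = A * (2 * sqnorm_n x (fun z => f0 z - fm m z) + pen m) + A1 * (Sigma x phi L / N)
    + A * (sqnorm_n x (fun z => f0 z - fm m z) + 2 * pen m).
  by field; rewrite !gt_eqF.
have sq0 : 0 <= sqnorm_n x (fun z => f0 z - fm m z).
  by rewrite -(ler_pM2l N0) mulr0 sqnormE // sumr_ge0 // => i _; rewrite sqr_ge0.
have : A * (KL x f0 (fm m) + pen m) <= A * (2 * sqnorm_n x (fun z => f0 z - fm m z) + pen m).
  by rewrite ler_pM2l // lerD2r.
have : 0 <= A * (sqnorm_n x (fun z => f0 z - fm m z) + 2 * pen m).
  by apply: mulr_ge0; [exact: ltW|apply: addr_ge0 => //; exact: mulr_ge0].
lra.
Qed.
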